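(* Suppose that a sequence $\{p_k\}$ generated by the inexact descent algorithm (with associated step sizes $\{t_k\}$ and directions $\{v_k\}$, each $v_k$ being s-compatible at $p_k$) has a cluster point $\bar p$. Then the following assertions hold: (i) If $\bar p$ is a Pareto critical point of $F$ and $F$ is quasi-convex around $\bar p$, then $\{p_k\}$ converges to $\bar p$. (ii) If $\bar p$ is a weak Pareto optimum of $\min_{p\in M}F(p)$, $\inf_{k\ge0}t_k>0$, and there exist $\alpha>0$ and $r>0$ such that $\|v(p)\|^2\ge\alpha\,\varphi(p)$ for each $p\in\mathbb{B}(\bar p,r)$, then $\{p_k\}$ converges linearly to $\bar p$.
   Context: $M$ is a connected, complete, $m$-dimensional Riemannian manifold with Riemannian distance $\mathrm{d}$; $\mathbb{B}(p,r)=\{q\in M:\mathrm{d}(p,q)\le r\}$. $I=\{1,\dots,n\}$ and $F=(f_i)_{i\in I}:M\to\mathbb{R}^n$ is continuously differentiable, with $JF(p)(v):=(\langle\nabla f_i(p),v\rangle)_{i\in I}$ for $v\in T_pM$. For $x,y\in\mathbb{R}^n$, $x\preceq y$ means $x_i\le y_i$ for all $i$, and $x\prec y$ means $x_i<y_i$ for all $i$. A point $p\in M$ is a Pareto critical point of $F$ if there is no $v\in T_pM$ with $\langle\nabla f_i(p),v\rangle<0$ for all $i\in I$. A point $p$ is a weak Pareto optimum of $\min_{p\in M}F(p)$ if there is no $q\in M$ with $F(q)\prec F(p)$. A set $Q\subseteq M$ is weakly convex if any two points of $Q$ are joined by a minimal geodesic of $M$ lying in $Q$. For $Q$ weakly convex,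 $F$ is quasi-convex on $Q$ if for all $p,q\in Q$ and every geodesic $\gamma:[0,1]\to M$ with $\gamma(0)=p$, $\gamma(1)=q$, $\gamma([0,1])\subseteq Q$, one has $F(\gamma(t))\preceq\max\{F(p),F(q)\}$ (componentwise max) for all $t\in[0,1]$. $F$ is quasi-convex around $x$ if it is quasi-convex on $\mathbb{B}(x,r)$ for some $r>0$ (with $\mathbb{B}(x,r)$ weakly convex). For $p\in M$, $\alpha_p(v):=\max_{i\in I}\langle\nabla f_i(p),v\rangle+\frac12\|v\|^2$ ($v\in T_pM$); $v(p)$ denotes the unique minimizer of $\alpha_p$ over $T_pM$ (the steepest descent direction at $p$), and $\alpha_p^*:=\alpha_p(v(p))$. For $\sigma\in[0,1)$, $D_\sigma(p):=\{v\in T_pM:\alpha_p(v)\le(1-\sigma)\alpha_p^*\}$. A vector $v\in T_pM$ is s-compatible at $p$ if $v=-\sum_{i\in I}\alpha_i\nabla f_i(p)$ for some $\alpha_i\in[0,1]$ with $\sum_{i\in I}\alpha_i=1$. The function $\varphi$ in (ii) is $\varphi(p):=\sup_{q\in M}\min_{i\in I}(f_i(p)-f_i(q))$. Inexact descent algorithm: fix $\sigma,\beta\in(0,1)$, $R\in[1,+\infty)$ and $p_0\in M$. At iteration $k=0,1,2,\dots$: if $p_k$ is a Pareto critical point, stop; otherwise choose $v_k\in D_\sigma(p_k)$, let $\gamma_k$ be the geodesic with $\gamma_k(0)=p_k$, $\gamma_k'(0)=v_k$, choose any $t_k\in(0,R]$ with $F(\gamma_k(t_k))\preceq F(p_k)+\beta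 t_kJF(p_k)(v_k)$, and set $p_{k+1}:=\gamma_k(t_k)$. Generated sequences are understood to be infinite (the algorithm does not stop). $\{p_k\}$ converges linearly to $\bar p$ means that there exist $C>0$ and $\theta\in(0,1)$ with $\mathrm{d}(p_k,\bar p)\le C\theta^k$ for all $k$. *)

(* Defs.v *)
From HB Require Import structures.
From mathcomp Require Import all_boot all_order all_algebra.
From mathcomp Require Import all_classical all_reals all_analysis.

Set Implicit Arguments.
Unset Strict Implicit.
Unset Printing Implicit Defensive.

Import Order.TTheory GRing.Theory Num.Theory.
Import numFieldNormedType.Exports.

Local Open Scope classical_set_scope.
Local Open Scope ring_scope.

Section Smoothness.
Context {R : realType} {V W : normedModType R}.

(* Class C^k on [U]; meaningful for [U] open. *)
Fixpoint Ck (k : nat) (U : set V) (f : V -> W) : Prop :=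
  match k with
  | 0 => forall x, U x -> {for x, continuous f}
  | k'.+1 => (forall x, U x -> differentiable f x) /\
             (forall v, Ck k' U (fun x => 'D_v f x))
  end.

Definition Cinfty (U : set V) (f : V -> W) : Prop := forall k, Ck k U f.

End Smoothness.

(* A smooth m-dimensional manifold without boundary. The atlas is indexed by
   the points of the manifold: [chart c] is a chart around [c]. Any smooth
   structure is generated by such an atlas. [chart c] and [chart_inv c] are
   total functions, but only matter on [chart_dom c] and its image. *)
Record manifold (R : realType) (m : nat) := Manifold {
  mpoint :> topologicalType ;
  mpoint_hausdorff : hausdorff_space mpoint ;
  mpoint_second_countable : @second_countable mpoint ;
  chart_dom : mpoint -> set mpoint ;
  chart : mpoint -> mpoint -> 'rV[R]_m ;
  chart_inv : mpoint -> 'rV[R]_m -> mpoint ;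
  chart_dom_open : forall c, open (chart_dom c) ;
  chart_dom_center : forall c, chart_dom c c ;
  chart_img_open : forall c, open (chart c @` chart_dom c) ;
  chartK : forall c p, chart_dom c p -> chart_inv c (chart c p) = p ;
  chart_continuous : forall c p, chart_dom c p -> {for p, continuous (chart c)} ;
  chart_inv_continuous : forall c p, chart_dom c p ->
    {for chart c p, continuous (chart_inv c)} ;
  transition_smooth : forall c c',
    Cinfty (chart c @` (chart_dom c `&` chart_dom c'))
           (chart c' \o chart_inv c)
}.

(* [gram c x] is the matrix of the metric, in the chart [c], at the point of
   coordinates [x]; [gram_transition] says that these matrices represent one
   and the same inner product on each tangent space. *)
Record riemannian (R : realType) (m : nat) := Riemannian {
  rmanifold :> manifold R m ;
  gram : rmanifold -> 'rV[R]_m -> 'M[R]_m ;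
  gram_smooth : forall c i j,
    Cinfty (chart c @` chart_dom c) (fun x => gram c x i j : R^o) ;
  gram_sym : forall c p, chart_dom c p ->
    (gram c (chart c p))^T = gram c (chart c p) ;
  gram_pos : forall c p (u : 'rV[R]_m), chart_dom c p -> u != 0 ->
    0 < (u *m gram c (chart c p) *m u^T) 0 0 ;
  gram_transition : forall c c' p (u v : 'rV[R]_m),
    chart_dom c p -> chart_dom c' p ->
    let dtau (w : 'rV[R]_m) : 'rV[R]_m :=
      'D_w (chart c' \o chart_inv c) (chart c p) in
    (u *m gram c (chart c p) *m v^T) 0 0 =
    (dtau u *m gram c' (chart c' p) *m (dtau v)^T) 0 0
}.

Section RiemannianGeometry.
Context {R : realType} {m : nat} {M : riemannian R m}.

Local Notation basis_vec i := (delta_mx 0 i : 'rV[R]_m).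

(* T_pM: a tangent vector at [p] is given by its coordinates in the chart
   [chart p] around [p]. *)
Definition tangent (p : M) : Type := 'rV[R]_m.

Definition inner (p : M) (u v : tangent p) : R :=
  (u *m gram p (chart p p) *m v^T) 0 0.
Arguments inner p u v : clear implicits.

Definition tnorm (p : M) (v : tangent p) : R := Num.sqrt (inner p v v).
Arguments tnorm p v : clear implicits.

(* The row d of partial derivatives satisfies df_p(v) = d v^T, hence
   <d G^-1, v> = df_p(v). *)
Definition grad (f : M -> R) (p : M) : tangent p :=
  (\row_j 'D_(basis_vec j) (f \o chart_inv p : _ -> R^o) (chart p p)) *m
  invmx (gram p (chart p p)).

(* Curves are total functions of which only the restriction to some interval
   matters. A curve is C^k on a closed interval when it is so on an open
   interval containing it. *)
Definition curve_Ck (k : nat) (J : set R) (gamma : R -> M) : Prop :=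
  (forall t, J t -> {for t, continuous gamma}) /\
  (forall c : M, Ck k (J `&` gamma @^-1` chart_dom c : set R^o)
                      (chart c \o gamma)).

Definition velocity (gamma : R -> M) (t : R) : tangent (gamma t) :=
  derive1 (chart (gamma t) \o gamma) t.

Definition curve_length (gamma : R -> M) (a b : R) : R :=
  \int[lebesgue_measure]_(t in `[a, b]) tnorm (gamma t) (velocity gamma t).

(* [piecewise_C1 p q l]: some piecewise C^1 curve of length [l] goes from [p]
   to [q]. *)
Inductive piecewise_C1 (p : M) : M -> R -> Prop :=
  | piecewise_C1_refl : piecewise_C1 p p 0
  | piecewise_C1_step q l (gamma : R -> M) (a b e : R) :
      piecewise_C1 p q l -> a <= b -> 0 < e ->
      curve_Ck 1 `]a - e, b + e[ gamma -> gamma a = q ->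
      piecewise_C1 p (gamma b) (l + curve_length gamma a b).

Definition rdist (p q : M) : R := inf [set l | piecewise_C1 p q l].

Definition rball (p : M) (r : R) : set M := [set q | rdist p q <= r].

Definition christoffel (c : M) (x : 'rV[R]_m) (k i j : 'I_m) : R :=
  let dg (a b d : 'I_m) : R :=
    'D_(basis_vec a) (fun y => gram c y b d : R^o) x in
  2^-1 * \sum_l invmx (gram c x) k l * (dg i j l + dg j i l - dg l i j).

Definition geodesic_on (J : set R) (gamma : R -> M) : Prop :=
  curve_Ck 2 J gamma /\
  forall (c : M) (t : R), J t -> chart_dom c (gamma t) ->
    let x := chart c \o gamma in
    forall k : 'I_m,
      derive1n 2 x t 0 k +
      \sum_i \sum_j christoffel c (x t) k i j * derive1 x t 0 i * derive1 x t 0 j = 0.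

Definition geodesic (a b : R) (gamma : R -> M) : Prop :=
  exists2 e : R, 0 < e & geodesic_on `]a - e, b + e[ gamma.

Definition geodesically_complete : Prop :=
  forall (p : M) (v : tangent p), exists gamma : R -> M,
    [/\ geodesic_on setT gamma, gamma 0 = p &
        derive1 (chart p \o gamma) 0 = v].

Definition weakly_convex (Q : set M) : Prop :=
  forall p q, Q p -> Q q -> exists gamma : R -> M,
    [/\ geodesic 0 1 gamma, gamma 0 = p, gamma 1 = q,
        curve_length gamma 0 1 = rdist p q &
        forall t, 0 <= t <= 1 -> Q (gamma t)].

End RiemannianGeometry.

Arguments inner {R m M} p u v.
Arguments tnorm {R m M} p v.
Arguments geodesically_complete {R m} M.

Section MultiobjectiveOptimization.
Context {R : realType} {m : nat} {M : riemannian R m}.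

Definition vle (n : nat) (x y : 'rV[R]_n) : Prop := forall i, x 0 i <= y 0 i.
Definition vlt (n : nat) (x y : 'rV[R]_n) : Prop := forall i, x 0 i < y 0 i.
Definition vmax (n : nat) (x y : 'rV[R]_n) : 'rV[R]_n :=
  \row_i Num.max (x 0 i) (y 0 i).

(* The objectives are indexed by ['I_n.+1], so that there is at least one and
   maxima and minima over them make sense. *)
Context {n : nat}.
Implicit Types (F : M -> 'rV[R]_n.+1) (p : M).

Definition objective F (i : 'I_n.+1) : M -> R := fun p => F p 0 i.

Definition C1_map F : Prop :=
  forall c : M, Ck 1 (chart c @` chart_dom c) (F \o chart_inv c).

Definition JF F p (v : tangent p) : 'rV[R]_n.+1 :=
  \row_i inner p (grad (objective F i) p) v.
Arguments JF F p v : clear implicits.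

Definition pareto_critical F p : Prop :=
  ~ exists v : tangent p, forall i, inner p (grad (objective F i) p) v < 0.

Definition weak_pareto_optimum F p : Prop := ~ exists q, vlt (F q) (F p).

Definition quasi_convex_on F (Q : set M) : Prop :=
  forall (p q : M) (gamma : R -> M), Q p -> Q q ->
    geodesic 0 1 gamma -> gamma 0 = p -> gamma 1 = q ->
    (forall t, 0 <= t <= 1 -> Q (gamma t)) ->
    forall t, 0 <= t <= 1 -> vle (F (gamma t)) (vmax (F p) (F q)).

Definition quasi_convex_around F p : Prop :=
  exists r : R, [/\ 0 < r, weakly_convex (rball p r) &
                    quasi_convex_on F (rball p r)].

Definition alpha F p (v : tangent p) : R :=
  \big[Num.max/inner p (grad (objective F ord0) p) v]_(i < n.+1)
     inner p (grad (objective F i) p) v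
  + 2^-1 * tnorm p v ^+ 2.
Arguments alpha F p v : clear implicits.

Definition steepest_descent F p : tangent p :=
  xget (0 : 'rV[R]_m) [set v : tangent p | forall u, alpha F p v <= alpha F p u].

Definition alpha_star F p : R := alpha F p (steepest_descent F p).

Definition descent_set F (sigma : R) p : set (tangent p) :=
  [set v | alpha F p v <= (1 - sigma) * alpha_star F p].
Arguments descent_set F sigma p _ : clear implicits.

Definition s_compatible F p (v : tangent p) : Prop :=
  exists a : 'I_n.+1 -> R,
    [/\ forall i, 0 <= a i <= 1, \sum_i a i = 1 &
        v = - \sum_i a i *: (grad (objective F i) p : 'rV[R]_m)].
Arguments s_compatible F p v : clear implicits.

(* A supremum that may be +oo. *)
Definition phi F p : \bar R :=
  ereal_sup [set (\big[Num.min/objective F ord0 p - objective F ord0 q]_(i < n.+1)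
                    (objective F i p - objective F i q))%:E | q in [set: M]].

(* [(p, v, t)] is an infinite run, with iterates [p], directions [v] and step
   sizes [t], of the inexact descent algorithm. *)
Definition inexact_descent F (sigma beta Rmax : R)
    (p : nat -> M) (v : forall k, tangent (p k)) (t : nat -> R) : Prop :=
  forall k,
    [/\ ~ pareto_critical F (p k),
        descent_set F sigma (p k) (v k),
        0 < t k <= Rmax &
        exists gamma : R -> M,
          [/\ geodesic 0 (t k) gamma,
              gamma 0 = p k,
              derive1 (chart (p k) \o gamma) 0 = v k,
              vle (F (gamma (t k))) (F (p k) + (beta * t k) *: JF F (p k) (v k)) &
              p k.+1 = gamma (t k)]].

Definition converges_linearly (p : nat -> M) (pbar : M) : Prop :=
  exists C theta : R, [/\ 0 < C, 0 < theta < 1 &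
    forall k, rdist (p k) pbar <= C * theta ^+ k].

End MultiobjectiveOptimization.

Arguments alpha {R m M n} F p v.
Arguments descent_set {R m M n} F sigma p _.
Arguments JF {R m M n} F p v.
Arguments s_compatible {R m M n} F p v.
Arguments inexact_descent {R m M n} F sigma beta Rmax p v t.

(* Main.v *)
(* Write d for the Riemannian distance.

   (i) Each step satisfies the quasi-Fejer inequality
   d(p_{k+1}, pbar)^2 <= d(p_k, pbar)^2 + C (t_k |v_k|)^2 as long as p_k is close
   to pbar. Indeed let y be a minimal geodesic from p_k to pbar. Since F pbar is
   below F p_k, quasi-convexity gives <grad f_i, y'(0)> <= 0 for all i, hence
   <v_k, y'(0)> >= 0 by s-compatibility, and the first variation of the energy of
   y bounds d(p_{k+1}, pbar)^2 with a quadratic error. The Armijo condition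
   dominates (t_k |v_k|)^2 by a multiple of f_0(p_k) - f_0(p_{k+1}), so that
   d(p_k, pbar)^2 + C' (f_0(p_k) - f_0(pbar)) decreases; it is arbitrarily small at
   an iterate close to the cluster point pbar.

   (ii) Put m_k := min_i (f_i(p_k) - f_i(pbar)) >= 0. The growth condition, used
   with the competitor q := pbar only, makes m_k decay geometrically while the
   iterates stay in the ball, and t_k |v_k| <= C sqrt(m_k), so the steps sum up to
   a length that cannot leave the ball. *)

Require Import Defs.
From mathcomp Require Import all_boot all_order all_algebra.
From mathcomp Require Import all_classical all_reals all_analysis.
From mathcomp Require Import ring lra.

Set Implicit Arguments.
Unset Strict Implicit.
Unset Printing Implicit Defensive.

Import Order.TTheory GRing.Theory Num.Theory.
Import numFieldNormedType.Exports.

Local Open Scope classical_set_scope.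
Local Open Scope ring_scope.

(** * Calculus *)

(** All metric estimates take place in the chart at [pbar], on a coordinate ball where the Gram
    matrix is coercive, bounded and has a quadratic Taylor bound. As [rdist] is an infimum over
    curves, distances are bounded above by exhibiting curves: coordinate segments, the geodesics of
    the run, or a perturbed minimal geodesic. The converse control, of coordinates by the distance,
    comes from minimal geodesics: their constant speed is the distance, coercivity turns it into a
    coordinate speed, and a continuity argument keeps the curve in the chart. Both parts face a
    circularity: the inequality that keeps the iterates near [pbar] holds only near [pbar]. In (i)
    it is broken by the Armijo decrease, which makes every step short once [f_0] is close to its
    value at [pbar]; a single step then stays where the inequality applies. In (ii) the induction
    carries the geometric decay of the gap and the length of the path travelled together. *)

Section Calculus.
Context {R : realType}.

Lemma is_derive_mxP (V : normedModType R) (m n : nat) (x : V -> 'M[R]_(m, n))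
    (t v : V) (d : 'M[R]_(m, n)) :
  is_derive t v x d <-> forall i j, is_derive t v (fun s => x s i j : R^o) (d i j).
Proof.
split=> [[dx <-] i j|dx].
  split; first by move/derivable_mxP : dx; apply.
  by rewrite derive_mx// mxE.
have dvx : derivable x t v by apply/derivable_mxP => i j; case: (dx i j).
split => //; rewrite derive_mx//; apply/matrixP => i j; rewrite mxE.
by case: (dx i j).
Qed.

Lemma is_derive_comp_diff (V W : normedModType R) (f : V -> W) (x : R -> V)
    (t : R) (d : V) :
  differentiable f (x t) -> is_derive t 1 x d ->
  is_derive t 1 (f \o x) ('D_d f (x t)).
Proof.
move=> df [dx <-].
have dxt : differentiable x t by exact/derivable1_diffP.
have dfx : differentiable (f \o x) t by exact: differentiable_comp.
split; first exact/derivable1_diffP.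
by rewrite deriveE// diff_comp//= -!deriveE.
Qed.

Lemma derive_basis (m : nat) (W : normedModType R) (f : 'rV[R]_m -> W)
    (a v : 'rV[R]_m) : differentiable f a ->
  'D_v f a = \sum_j v 0 j *: 'D_(delta_mx 0 j) f a.
Proof.
move=> df; rewrite deriveE// {1}(row_sum_delta v) linear_sum/=.
by apply: eq_bigr => j _; rewrite linearZ/= deriveE.
Qed.

Lemma normr_mx_le (m n : nat) (x : 'M[R]_(m, n)) (C : R) : 0 <= C ->
  (forall i j, `|x i j| <= C) -> `|x| <= C.
Proof.
by move=> C0 xC; rewrite /Num.Def.normr/= mx_normrE (bigmax_le _ C0)//= => -[i j].
Qed.

Lemma normr_mx_entry (m n : nat) (x : 'M[R]_(m, n)) i j : `|x i j| <= `|x|.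
Proof.
by rewrite [leRHS]/Num.Def.normr/= mx_normrE; exact: (le_bigmax _ _ (i, j)).
Qed.

Lemma is_derive1_continuous (V : normedModType R) (f : R -> V) (t : R) (d : V) :
  is_derive t 1 f d -> {for t, continuous f}.
Proof. by move=> [df _]; exact/differentiable_continuous/derivable1_diffP. Qed.

Lemma within_continuous_for (T U : topologicalType) (f : T -> U) (A : set T) :
  (forall x, A x -> {for x, continuous f}) -> {within A, continuous f}.
Proof. by move=> cf; apply: continuous_in_subspaceT => x /set_mem; exact: cf. Qed.

Lemma derive_bound (f df : R -> R) (a b C : R) : a <= b ->
  (forall s, a <= s <= b -> is_derive s 1 f (df s)) ->
  (forall s, a <= s <= b -> `|df s| <= C) -> `|f b - f a| <= C * (b - a).
Proof.
move=> ab fdf dfC.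
have [|x|c cab ->] := @MVT_segment R f df a b ab.
- by move=> x; rewrite in_itv/= => /andP[ax xb]; apply: fdf; rewrite !ltW.
- by apply: within_continuous_for => {}x /=; rewrite in_itv/= => /fdf/is_derive1_continuous.
rewrite normrM (ger0_norm (_ : 0 <= b - a)) ?subr_ge0// ler_wpM2r ?subr_ge0//.
by apply: dfC; rewrite in_itv/= in cab.
Qed.

(** The norm of a matrix is the maximum of its entries, so the scalar inequality applies entrywise
    without loss in the constant. *)
Lemma derive_bound_mx (m n : nat) (f df : R -> 'M[R]_(m, n)) (a b C : R) :
  a <= b -> 0 <= C ->
  (forall s, a <= s <= b -> is_derive s 1 f (df s)) ->
  (forall s, a <= s <= b -> `|df s| <= C) -> `|f b - f a| <= C * (b - a).
Proof.
move=> ab C0 fdf dfC; apply: normr_mx_le.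
  by rewrite mulr_ge0// subr_ge0.
move=> i j; rewrite !mxE.
apply: (@derive_bound (fun s => f s i j) (fun s => df s i j)) => // s sab.
  by have /is_derive_mxP := fdf _ sab; apply.
exact: le_trans (normr_mx_entry _ _ _) (dfC _ sab).
Qed.

Lemma ler_sum_term (I : finType) (f : I -> R) i :
  (forall j, 0 <= f j) -> f i <= \sum_j f j.
Proof. by move=> f0; rewrite (bigD1 i)//= lerDl sumr_ge0. Qed.

Lemma is_derive_line (V : normedModType R) (x w : V) (s : R) :
  is_derive s 1 (fun u : R => x + u *: w) w.
Proof.
have D : is_derive s 1 ( *:%R^~ w : R -> V) w.
  split; first exact/derivable1_diffP.
  by rewrite deriveE// diff_val scale1r.
have -> : (fun u : R => x + u *: w) = cst x + ( *:%R^~ w : R -> V) by [].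
by apply: is_derive_eq; rewrite add0r.
Qed.

(** The integral of a nonnegative function is a supremum over the simple functions below it, and
    those below [f] are below [g]. It is meant for the speed of a curve, which is not shown to be
    measurable. *)
Lemma le_integral_noM d (T : measurableType d) (mu : {measure set T -> \bar R})
    (D : set T) (f g : T -> \bar R) :
  (forall x, D x -> (0 <= f x)%E) -> (forall x, D x -> (f x <= g x)%E) ->
  (\int[mu]_(x in D) f x <= \int[mu]_(x in D) g x)%E.
Proof.
move=> f0 fg; rewrite !ge0_integralE//; last first.
  by move=> x Dx; exact: le_trans (f0 _ Dx) (fg _ Dx).
apply: le_ereal_sup => _ [h hf <-]; exists h => // x.
by apply: (le_trans (hf x)); exact: lee_restrict.
Qed.

Lemma Rintegral_le_primitive (f psi dpsi : R -> R) (a b : R) : a <= b ->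
  (forall s, a <= s <= b -> is_derive s 1 psi (dpsi s)) ->
  (forall s, a <= s <= b -> {for s, continuous dpsi}) ->
  (forall s, a <= s <= b -> 0 <= f s <= dpsi s) ->
  \int[lebesgue_measure]_(s in `[a, b]) f s <= psi b - psi a.
Proof.
rewrite le_eqVlt => /predU1P[<-{b}|ab] psiE dpsic fdpsi.
  by rewrite set_itv1 Rintegral_set1 subrr.
have psib : (\int[lebesgue_measure]_(s in `[a, b]) (dpsi s)%:E =
    (psi b)%:E - (psi a)%:E)%E.
  apply: continuous_FTC2 => //.
  - by apply: within_continuous_for => s /=; rewrite in_itv/=; exact: dpsic.
  - split.
    + by move=> s; rewrite in_itv/= => /andP[a_s sb]; case: (psiE s) => //; rewrite !ltW.
    + apply: cvg_at_right_filter; apply: is_derive1_continuous (psiE a _).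
      by rewrite lexx ltW.
    + apply: cvg_at_left_filter; apply: is_derive1_continuous (psiE b _).
      by rewrite lexx ltW.
  - move=> s; rewrite in_itv/= => /andP[a_s sb]; rewrite derive1E.
    by case: (psiE s) => //; rewrite !ltW.
have fin : (\int[lebesgue_measure]_(s in `[a, b]) (f s)%:E <=
    (psi b)%:E - (psi a)%:E)%E.
  rewrite -psib; apply: le_integral_noM => s /=; rewrite in_itv/= => /fdpsi/andP[].
    by rewrite lee_fin.
  by rewrite lee_fin.
have pos : (0 <= \int[lebesgue_measure]_(s in `[a, b]) (f s)%:E)%E.
  by apply: integral_ge0 => s /=; rewrite in_itv/= => /fdpsi/andP[]; rewrite lee_fin.
(* [Rintegral] is the [fine] part of the extended integral; the bound passes to it because [pos] and
   [fin] make that integral finite. *)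
rewrite /Rintegral -lee_fin fineK// ge0_fin_numE//.
by apply: le_lt_trans fin _; rewrite -EFinB ltry.
Qed.

End Calculus.

(** * Bilinear forms *)

Section BilinearForms.
Context {R : realType} {m : nat}.
Implicit Types (A B : 'M[R]_m) (a b c u v w : 'rV[R]_m).

(** [inner p] is convertible to [form] of the Gram matrix at [p]; later proofs switch between the
    two by conversion. *)
Definition form A a b : R := (a *m A *m b^T) 0 0.

Lemma formE A a b : form A a b = \sum_i \sum_j a 0 i * A i j * b 0 j.
Proof.
rewrite /form mxE exchange_big/=; apply: eq_bigr => j _.
by rewrite !mxE big_distrl.
Qed.

Lemma formDm A B a b : form (A + B) a b = form A a b + form B a b.
Proof. by rewrite /form mulmxDr mulmxDl mxE. Qed.

Lemma formDl A a b c : form A (a + b) c = form A a c + form A b c.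
Proof. by rewrite /form !mulmxDl mxE. Qed.

Lemma formDr A a b c : form A a (b + c) = form A a b + form A a c.
Proof. by rewrite /form linearD/= mulmxDr mxE. Qed.

Lemma formZm k A a b : form (k *: A) a b = k * form A a b.
Proof. by rewrite /form -scalemxAr -scalemxAl mxE. Qed.

Lemma formZl k A a b : form A (k *: a) b = k * form A a b.
Proof. by rewrite /form -!scalemxAl mxE. Qed.

Lemma formZr k A a b : form A a (k *: b) = k * form A a b.
Proof. by rewrite /form linearZ/= -scalemxAr mxE. Qed.

Lemma formNl A a b : form A (- a) b = - form A a b.
Proof. by rewrite -scaleN1r formZl mulN1r. Qed.

Lemma formNr A a b : form A a (- b) = - form A a b.
Proof. by rewrite -scaleN1r formZr mulN1r. Qed.

Lemma formBl A a b c : form A (a - b) c = form A a c - form A b c.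
Proof. by rewrite formDl formNl. Qed.

Lemma formBr A a b c : form A a (b - c) = form A a b - form A a c.
Proof. by rewrite formDr formNr. Qed.

Lemma formBm A B a b : form (A - B) a b = form A a b - form B a b.
Proof. by rewrite formDm -scaleN1r formZm mulN1r. Qed.

Lemma form0l A b : form A 0 b = 0.
Proof. by rewrite /form !mul0mx mxE. Qed.

Lemma form_suml (I : finType) A (f : I -> 'rV[R]_m) b :
  form A (\sum_i f i) b = \sum_i form A (f i) b.
Proof. by rewrite /form !mulmx_suml summxE. Qed.

Lemma form_sym A a b : A^T = A -> form A a b = form A b a.
Proof.
move=> Asym; transitivity ((a *m A *m b^T)^T 0 0); first by rewrite mxE.
by rewrite !trmx_mul trmxK Asym mulmxA.
Qed.

(** The factor [m%:R ^+ 2] counts the index pairs of the double sum, each term being bounded through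
    the maximum norm. *)
Lemma form_bound A a b : `|form A a b| <= m%:R ^+ 2 * `|A| * `|a| * `|b|.
Proof.
rewrite formE; apply: (le_trans (ler_norm_sum _ _ _)).
have -> : m%:R ^+ 2 * `|A| * `|a| * `|b| =
    \sum_(i < m) \sum_(j < m) `|a| * `|A| * `|b|.
  rewrite !sumr_const card_ord -(mulr_natl (_ *+ _)) -(mulr_natl (_ * _)); ring.
apply: ler_sum => i _; apply: (le_trans (ler_norm_sum _ _ _)).
apply: ler_sum => j _; rewrite !normrM.
by do !apply: ler_pM => //; exact: normr_mx_entry.
Qed.

Lemma form_bound_le A a b (k la lb : R) : `|A| <= k -> `|a| <= la -> `|b| <= lb ->
  `|form A a b| <= m%:R ^+ 2 * k * la * lb.
Proof.
move=> Ak al bl; apply: (le_trans (form_bound _ _ _)).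
have m0 : 0 <= m%:R ^+ 2 :> R by exact: sqr_ge0.
have h0 := normr_ge0 A; have h1 := normr_ge0 a; have h2 := normr_ge0 b.
have k0 := le_trans h0 Ak; have l0 := le_trans h1 al.
by do 3 (apply: ler_pM => //; rewrite ?mulr_ge0//).
Qed.

Lemma is_derive_form (A : R -> 'M[R]_m) (a b : R -> 'rV[R]_m) (t : R) A' a' b' :
  is_derive t 1 A A' -> is_derive t 1 a a' -> is_derive t 1 b b' ->
  is_derive t 1 (fun s => form (A s) (a s) (b s))
    (form A' (a t) (b t) + form (A t) a' (b t) + form (A t) (a t) b').
Proof.
move=> /is_derive_mxP dA /is_derive_mxP da /is_derive_mxP db.
have -> : (fun s => form (A s) (a s) (b s)) = \sum_(i < m) \sum_(j < m)
    ((fun s => a s 0 i) * (fun s => A s i j) * (fun s => b s 0 j)).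
  apply/funext => s; rewrite formE !fct_sumE; apply: eq_bigr => i _.
  by rewrite fct_sumE.
apply: is_derive_eq; rewrite !formE -!big_split/=; apply: eq_bigr => i _.
rewrite -!big_split/=; apply: eq_bigr => j _.
rewrite /GRing.scale/= [X in X * _ + _ = _]/GRing.mul/=; ring.
Qed.

Lemma continuous_form (T : topologicalType) (A : T -> 'M[R]_m)
    (a b : T -> 'rV[R]_m) (t : T) :
  {for t, continuous A} -> {for t, continuous a} -> {for t, continuous b} ->
  {for t, continuous (fun s => form (A s) (a s) (b s))}.
Proof.
have coord p q (X : T -> 'M[R]_(p, q)) i j : {for t, continuous X} ->
    {for t, continuous (fun s => X s i j)}.
  move=> cX; apply: (@continuous_comp _ _ _ X (fun M : 'M[R]_(p, q) => M i j)) => //.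
  exact: coord_continuous.
move=> cA ca cb; rewrite /prop_for/continuous_at.
under eq_cvg do rewrite formE; rewrite formE.
apply: cvg_big => [|i _]; first exact: add_continuous.
apply: cvg_big => [|j _]; first exact: add_continuous.
by apply: cvgM; [apply: cvgM|]; exact: coord.
Qed.

Definition posdef A := A^T = A /\ forall u, u != 0 -> 0 < form A u u.

Lemma posdef_ge0 A u : posdef A -> 0 <= form A u u.
Proof.
move=> [_ Apos]; have [->|/Apos/ltW//] := eqVneq u 0.
by rewrite form0l.
Qed.

Lemma posdef_unitmx A : posdef A -> A \in unitmx.
Proof.
move=> [_ Apos]; rewrite -row_free_unit; apply/inj_row_free => u uA0.
by apply/eqP/negP => /negP/Apos; rewrite /form uA0 mul0mx mxE ltxx.
Qed.

(** The form is evaluated at [form A a a *: b - form A a b *: a], a multiple of the component of [b]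
    orthogonal to [a]. *)
Lemma form_cauchy_schwarz A a b : posdef A ->
  form A a b ^+ 2 <= form A a a * form A b b.
Proof.
move=> Apd; have [Asym Apos] := Apd.
have [->|a0] := eqVneq a 0; first by rewrite !form0l mul0r expr0n.
have aa0 := Apos _ a0.
have := posdef_ge0 (form A a a *: b - form A a b *: a) Apd.
rewrite !(formBl, formBr, formZl, formZr) (form_sym b a Asym).
set x := form A a a in aa0 *; set y := form A a b; set z := form A b b.
rewrite [X in 0 <= X -> _](_ : _ = x * (x * z - y ^+ 2)); last by ring.
by rewrite pmulr_rge0// subr_ge0.
Qed.

(** Each coordinate is a product with a fixed vector, [a 0 i = form A (z i) a] with [z i] the [i]-th
    row of the inverse; Cauchy-Schwarz then bounds [a 0 i ^+ 2] by a constant times [form A a a]. *)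
Lemma posdef_coercive A : posdef A ->
  exists2 lam : R, 0 < lam & forall a, lam * `|a| ^+ 2 <= form A a a.
Proof.
move=> Apd; pose z i := delta_mx 0 i *m invmx A : 'rV[R]_m.
have zE i a : form A (z i) a = a 0 i.
  rewrite /form /z mulmxKV ?posdef_unitmx// mxE (bigD1 i)//= !mxE !eqxx mul1r.
  rewrite big1 ?addr0// => j ji; rewrite mxE eqxx/= (negbTE ji) mul0r//.
(* The [1 +] keeps [K] positive in dimension [0]. *)
pose K := 1 + \sum_i form A (z i) (z i).
have zK i : form A (z i) (z i) <= K.
  rewrite /K (bigD1 i)//= addrCA lerDl addr_ge0// sumr_ge0// => j _.
  exact: posdef_ge0.
have K0 : 0 < K by rewrite ltr_pwDl// sumr_ge0// => j _; exact: posdef_ge0.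
exists K^-1 => [|a]; first by rewrite invr_gt0.
rewrite ler_pdivrMl//.
have aK : 0 <= K * form A a a by rewrite mulr_ge0 ?posdef_ge0// ltW.
rewrite -(sqr_sqrtr aK) lerXn2r ?nnegrE ?sqrtr_ge0//.
apply: normr_mx_le => [|k i]; first exact: sqrtr_ge0.
rewrite (ord1 k).
rewrite -[leLHS]sqrtr_sqr ler_wsqrtr// -zE.
apply: (le_trans (form_cauchy_schwarz _ _ Apd)).
by rewrite ler_wpM2r ?posdef_ge0.
Qed.

End BilinearForms.

(** * Charts, velocities and paths *)

Section Charts.
Context {R : realType} {m : nat} {M : riemannian R m}.
Implicit Types (c p q : M) (gamma : R -> M) (t : R) (a b u w : 'rV[R]_m).

Lemma chart_dom_nbhs c p : chart_dom c p -> \forall q \near p, chart_dom c q.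
Proof. by move=> cp; apply: open_nbhs_nbhs; split => //; exact: chart_dom_open. Qed.

Lemma curve_chart_dom_nbhs c gamma t : {for t, continuous gamma} ->
  chart_dom c (gamma t) -> \forall s \near t, chart_dom c (gamma s).
Proof. by move=> cg /chart_dom_nbhs; exact: cg. Qed.

Lemma gram_posdef c p : chart_dom c p -> posdef (gram c (chart c p)).
Proof. by move=> cp; split=> [|u u0]; [exact: gram_sym|exact: gram_pos]. Qed.

Lemma transition_C1 c c' p : chart_dom c p -> chart_dom c' p ->
  differentiable (chart c' \o chart_inv c : 'rV[R]_m -> _) (chart c p) /\
  forall v, {for chart c p, continuous ('D_v (chart c' \o chart_inv c))}.
Proof.
move=> cp c'p; have [/= dt ct] := @transition_smooth _ _ M c c' 1.
have ip : (chart c @` (chart_dom c `&` chart_dom c')) (chart c p) by exists p.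
by split=> [|v]; [exact: dt|exact: ct].
Qed.

Lemma is_derive_chart c c' gamma t w : {for t, continuous gamma} ->
  chart_dom c (gamma t) -> chart_dom c' (gamma t) ->
  is_derive t 1 (chart c \o gamma) w ->
  is_derive t 1 (chart c' \o gamma)
    ('D_w (chart c' \o chart_inv c) (chart c (gamma t))).
Proof.
move=> cg cgt c'gt dx; have [dtau _] := transition_C1 cgt c'gt.
have dy := is_derive_comp_diff dtau dx.
apply: near_eq_is_derive dy.
near=> s => /=; rewrite chartK//.
by near: s; exact: curve_chart_dom_nbhs.
Unshelve. all: by end_near. Qed.

(* The metric seen through the velocities of two curves crossing at a point
   does not depend on the chart. *)
Lemma form_chart c c' q gamma1 gamma2 t1 t2 w1 w2 w1' w2' :
  chart_dom c q -> chart_dom c' q ->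
  gamma1 t1 = q -> gamma2 t2 = q ->
  {for t1, continuous gamma1} -> {for t2, continuous gamma2} ->
  is_derive t1 1 (chart c \o gamma1) w1 -> is_derive t2 1 (chart c \o gamma2) w2 ->
  is_derive t1 1 (chart c' \o gamma1) w1' -> is_derive t2 1 (chart c' \o gamma2) w2' ->
  form (gram c (chart c q)) w1 w2 = form (gram c' (chart c' q)) w1' w2'.
Proof.
move=> cq c'q g1 g2 cg1 cg2 d1 d2 d1' d2'.
rewrite /form (gram_transition w1 w2 cq c'q).
have uniq gamma t w w' : gamma t = q -> {for t, continuous gamma} ->
    is_derive t 1 (chart c \o gamma) w -> is_derive t 1 (chart c' \o gamma) w' ->
    'D_w (chart c' \o chart_inv c) (chart c q) = w'.
  move=> gt cg dw dw'; rewrite -gt in cq c'q *.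
  have [_ <-] := is_derive_chart cg cq c'q dw.
  by case: dw'.
by rewrite (uniq _ _ _ _ g1 cg1 d1 d1') (uniq _ _ _ _ g2 cg2 d2 d2').
Qed.

(** Derivability is asked in every chart at the point, so that velocities can be compared between
    the chart at [gamma t] and a fixed one. *)
Definition curve_derivable gamma t : Prop :=
  {for t, continuous gamma} /\
  forall c, chart_dom c (gamma t) -> derivable (chart c \o gamma) t 1.

Lemma curve_derivableP c gamma t : curve_derivable gamma t ->
  chart_dom c (gamma t) ->
  is_derive t 1 (chart c \o gamma) (derive1 (chart c \o gamma) t).
Proof. by move=> [_ /(_ c)] + cg => /(_ cg) dg; rewrite derive1E; exact/derivableP. Qed.

(** [velocity] is expressed in a chart that moves with [gamma t]; the right-hand side lives in a
    fixed chart, where it can be differentiated in [t]. *)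
Lemma speed_chart c gamma t : curve_derivable gamma t -> chart_dom c (gamma t) ->
  tnorm (gamma t) (velocity gamma t) ^+ 2 =
  form (gram c (chart c (gamma t))) (derive1 (chart c \o gamma) t)
                                    (derive1 (chart c \o gamma) t).
Proof.
move=> dg cg; have gg := chart_dom_center (gamma t).
rewrite /tnorm sqr_sqrtr; last exact: (posdef_ge0 _ (gram_posdef gg)).
have [cont _] := dg.
apply: (form_chart gg cg erefl erefl cont cont); exact: curve_derivableP.
Qed.

Lemma Ck_le (V W : normedModType R) k U (f : V -> W) : Ck k.+1 U f -> Ck k U f.
Proof.
elim: k f => [|k IH] f [df cf].
  by move=> x Ux; exact/differentiable_continuous/df.
by split => // v; exact: IH.
Qed.

Lemma curve_Ck_le k J gamma : curve_Ck k.+1 J gamma -> curve_Ck k J gamma.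
Proof. by move=> [cg dg]; split => // c; exact: Ck_le. Qed.

Lemma curve_C1_derivable J gamma t : curve_Ck 1 J gamma -> J t ->
  curve_derivable gamma t.
Proof.
move=> [cg dg] Jt; split=> [|c cgt]; first exact: cg.
by have [+ _] := dg c => /(_ t (conj Jt cgt)); exact: diff_derivable.
Qed.

Lemma geodesic_on_derivable J gamma t : geodesic_on J gamma -> J t ->
  curve_derivable gamma t.
Proof. by move=> [/curve_Ck_le + _]; exact: curve_C1_derivable. Qed.

End Charts.

(** * Geodesics: the Euler-Lagrange equation and constant speed *)

Section GeodesicEquation.
Context {R : realType} {m : nat} {M : riemannian R m}.
Implicit Types (c p q : M) (gamma : R -> M) (t : R) (a b h x : 'rV[R]_m).

Definition dgram c x h : 'M[R]_m :=
  \matrix_(i, j) 'D_h (fun y => gram c y i j : R^o) x.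

Lemma gram_entry_differentiable c x i j : (chart c @` chart_dom c) x ->
  differentiable (fun y => gram c y i j : R^o) x.
Proof. by move=> cx; have [+ _] := @gram_smooth _ _ M c i j 1; apply. Qed.

Lemma dgram_basis c x h : (chart c @` chart_dom c) x ->
  dgram c x h = \sum_l h 0 l *: dgram c x (delta_mx 0 l).
Proof.
move=> cx; apply/matrixP => i j; rewrite summxE mxE derive_basis.
  by apply: eq_bigr => l _; rewrite !mxE.
exact: gram_entry_differentiable.
Qed.

Lemma form_dgram c x h a b : (chart c @` chart_dom c) x ->
  form (dgram c x h) a b =
  \sum_l \sum_i \sum_j
    h 0 l * 'D_(delta_mx 0 l) (fun y => gram c y i j : R^o) x * a 0 i * b 0 j.
Proof.
move=> cx; rewrite dgram_basis// formE exchange_big/=.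
under eq_bigr => j _ do under eq_bigr => i _ do
  rewrite summxE mulr_sumr mulr_suml.
rewrite exchange_big/=; under eq_bigr do rewrite exchange_big/=.
rewrite exchange_big/=; apply: eq_bigr => l _; apply: eq_bigr => i _.
by apply: eq_bigr => j _; rewrite !mxE; ring.
Qed.

Lemma dgramZ c x k h : (chart c @` chart_dom c) x ->
  dgram c x (k *: h) = k *: dgram c x h.
Proof.
move=> cx; rewrite !(dgram_basis _ cx) scaler_sumr; apply: eq_bigr => l _.
by rewrite mxE scalerA.
Qed.

Lemma chart_img_nbhs c x : (chart c @` chart_dom c) x ->
  \forall y \near x, (chart c @` chart_dom c) y.
Proof. by move=> cx; apply: open_nbhs_nbhs; split => //; exact: chart_img_open. Qed.

Lemma dgram_sym c x h : (chart c @` chart_dom c) x -> (dgram c x h)^T = dgram c x h.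
Proof.
move=> cx; apply/matrixP => i j; rewrite !mxE; apply: near_eq_derive.
near=> y.
have [p cp <-] : (chart c @` chart_dom c) y by near: y; exact: chart_img_nbhs.
by rewrite -[in LHS](gram_sym cp) mxE.
Unshelve. all: by end_near. Qed.

Lemma is_derive_gram c (x : R -> 'rV[R]_m) t d : (chart c @` chart_dom c) (x t) ->
  is_derive t 1 x d ->
  is_derive t 1 (fun s => gram c (x s)) (dgram c (x t) d).
Proof.
move=> cx dx; apply/is_derive_mxP => i j; rewrite mxE.
exact: (is_derive_comp_diff (gram_entry_differentiable i j cx) dx).
Qed.

Lemma continuous_mx (T : topologicalType) (p q : nat) (X : T -> 'M[R]_(p, q)) s :
  (forall i j, {for s, continuous (fun u => X u i j : R)}) -> {for s, continuous X}.
Proof.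
move=> cX; apply/cvgrPdist_le => e e0; near=> u.
rewrite [leLHS]/Num.Def.normr/= mx_normrE (bigmax_le _ (ltW e0))//= => -[i j] _.
rewrite !mxE/=; move: i j; near: u; apply: filter_forall => i.
apply: filter_forall => j.
by have /cvgrPdist_le := cX i j; apply.
Unshelve. all: by end_near. Qed.

Lemma dgram_continuous c x h : (chart c @` chart_dom c) x ->
  {for x, continuous (fun y => dgram c y h)}.
Proof.
move=> cx; apply: continuous_mx => i j.
have -> : (fun y => dgram c y h i j) = 'D_h (fun y => gram c y i j : R^o).
  by apply/funext => y; rewrite mxE.
by have [_ +] := @gram_smooth _ _ M c i j 1; apply.
Qed.

Lemma gram_continuous c x : (chart c @` chart_dom c) x ->
  {for x, continuous (gram c)}.
Proof.
move=> cx; apply: continuous_mx => i j.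
exact/differentiable_continuous/gram_entry_differentiable.
Qed.

(** Multiplication by the metric cancels the inverse matrix in the Christoffel symbols ([lower]).
    Contracted with the symmetric product of [h] by itself, their first two terms agree ([E2]) and
    add up to [form (dgram c x h) a h]; the third gives the subtracted term. *)
Lemma form_christoffel c q a (h : 'rV[R]_m) : chart_dom c q ->
  let x := chart c q in
  \sum_k (a *m gram c x) 0 k *
     (\sum_i \sum_j christoffel c x k i j * h 0 i * h 0 j) =
  form (dgram c x h) a h - 2^-1 * form (dgram c x a) h h.
Proof.
move=> cq x; have cx : (chart c @` chart_dom c) x by exists q.
pose dg l i j := 'D_(delta_mx 0 l) (fun y => gram c y i j : R^o) x.
have lower i j : \sum_k (a *m gram c x) 0 k * christoffel c x k i j =
    2^-1 * \sum_l a 0 l * (dg i j l + dg j i l - dg l i j).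
  rewrite mulr_sumr; under eq_bigr => k _ do
    rewrite /christoffel mulrCA mulr_sumr mulr_sumr.
  rewrite exchange_big/=; apply: eq_bigr => l _.
  rewrite -mulr_sumr; congr (_ * _); under eq_bigr do rewrite mulrA.
  rewrite -mulr_suml; congr (_ * _).
  have := mulmxK (posdef_unitmx (gram_posdef cq)) a.
  by move/(congr1 (fun v : 'rV_m => v 0 l)); rewrite mxE.
transitivity (\sum_i \sum_j
    (2^-1 * \sum_l a 0 l * (dg i j l + dg j i l - dg l i j)) * h 0 i * h 0 j).
  under eq_bigr do rewrite mulr_sumr.
  rewrite exchange_big/=; apply: eq_bigr => i _.
  under eq_bigr do rewrite mulr_sumr.
  rewrite exchange_big/=; apply: eq_bigr => j _.
  by rewrite -lower !mulr_suml; apply: eq_bigr => k _; rewrite !mulrA.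
have -> : form (dgram c x h) a h =
    2^-1 * form (dgram c x h) h a + 2^-1 * form (dgram c x h) h a.
  rewrite (form_sym a h (dgram_sym _ cx)) -mulrDl.
  by rewrite (_ : 2^-1 + 2^-1 = 1 :> R) ?mul1r//; field.
rewrite -mulrDr -mulrBr.
have -> : form (dgram c x h) h a =
    \sum_i \sum_j \sum_l a 0 l * dg i j l * h 0 i * h 0 j.
  rewrite form_dgram//; apply: eq_bigr => i _; apply: eq_bigr => j _.
  by apply: eq_bigr => l _; rewrite /dg; ring.
have E2 : \sum_i \sum_j \sum_l a 0 l * dg i j l * h 0 i * h 0 j =
    \sum_i \sum_j \sum_l a 0 l * dg j i l * h 0 i * h 0 j.
  rewrite exchange_big/=; apply: eq_bigr => i _; apply: eq_bigr => j _.
  by apply: eq_bigr => l _; ring.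
rewrite [X in _ * (_ + X - _)]E2.
have -> : form (dgram c x a) h h =
    \sum_i \sum_j \sum_l a 0 l * dg l i j * h 0 i * h 0 j.
  rewrite form_dgram// exchange_big/=; apply: eq_bigr => i _.
  by rewrite exchange_big/=.
rewrite -big_split/= -sumrB mulr_sumr; apply: eq_bigr => i _.
rewrite -big_split/= -sumrB mulr_sumr; apply: eq_bigr => j _.
rewrite -!mulrA; congr (_ * _); rewrite -big_split/= -sumrB mulr_suml.
by apply: eq_bigr => l _; ring.
Qed.

(* The geodesic equation with the index lowered, i.e., the Euler-Lagrange
   equation of the energy. *)
Lemma geodesic_lowered J gamma c t a : geodesic_on J gamma -> J t ->
  chart_dom c (gamma t) ->
  let x := chart c \o gamma in
  form (gram c (x t)) a (derive1n 2 x t) =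
  2^-1 * form (dgram c (x t) a) (derive1 x t) (derive1 x t) -
  form (dgram c (x t) (derive1 x t)) a (derive1 x t).
Proof.
move=> [_ geo] Jt cgt x.
have {}geo k := geo c t Jt cgt k.
rewrite -[RHS]opprB /x -form_christoffel// /form mxE -sumrN; apply: eq_bigr => k _.
rewrite [_^T _ _]mxE -mulrN; congr (_ * _); apply/eqP.
by rewrite -addr_eq0; apply/eqP/geo.
Qed.

Lemma geodesic_on_derive2 J gamma c t : open J -> geodesic_on J gamma -> J t ->
  chart_dom c (gamma t) ->
  is_derive t 1 (derive1 (chart c \o gamma)) (derive1n 2 (chart c \o gamma) t).
Proof.
move=> Jo [[_ /(_ c)[_ /(_ 1)[dd _]]] _] Jt cgt.
have E : 'D_1 (chart c \o gamma) = derive1 (chart c \o gamma).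
  by apply/funext => s; rewrite derive1E.
rewrite derive1nS derive1n1 derive1E; rewrite E in dd.
by apply: derivableP; apply: diff_derivable; exact: dd.
Qed.

(** The derivative of the metric along the curve cancels the last term of [geodesic_lowered]. Only
    first derivatives of the curve remain on the right. *)
Lemma euler_lagrange J gamma c t a : open J -> geodesic_on J gamma -> J t ->
  chart_dom c (gamma t) ->
  let x := chart c \o gamma in
  is_derive t 1 (fun s => form (gram c (x s)) a (derive1 x s))
    (2^-1 * form (dgram c (x t) a) (derive1 x t) (derive1 x t)).
Proof.
move=> Jo geo Jt cgt x.
have dx : is_derive t 1 x (derive1 x t).
  exact: curve_derivableP (geodesic_on_derivable geo Jt) cgt.
have cx : (chart c @` chart_dom c) (x t) by exists (gamma t).
have := is_derive_form (is_derive_gram cx dx) (is_derive_cst a t 1)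
  (geodesic_on_derive2 Jo geo Jt cgt).
move=> D; refine (is_derive_eq D _).
by rewrite form0l addr0 (geodesic_lowered a geo Jt cgt) addrC subrK.
Qed.

(** The square is differentiated because the norm need not be differentiable where the speed
    vanishes. With [a] the velocity itself, [dgram] contributes once through the metric and
    [2 * (2^-1 - 1)] times through [geodesic_lowered], in total [0]. *)
Lemma geodesic_speed_derive J gamma t : open J -> geodesic_on J gamma -> J t ->
  is_derive t 1 (fun s => tnorm (gamma s) (velocity gamma s) ^+ 2) 0.
Proof.
move=> Jo geo Jt; pose c := gamma t; pose x := chart c \o gamma.
have cgt : chart_dom c (gamma t) by exact: chart_dom_center.
have [gct _] := geodesic_on_derivable geo Jt.
have dx : is_derive t 1 x (derive1 x t).
  exact: curve_derivableP (geodesic_on_derivable geo Jt) cgt.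
have cx : (chart c @` chart_dom c) (x t) by exists (gamma t).
have dd := geodesic_on_derive2 Jo geo Jt cgt.
have D := is_derive_form (is_derive_gram cx dx) dd dd.
apply: (near_eq_is_derive (f := fun s => form (gram c (x s)) (derive1 x s) (derive1 x s))).
  near=> s; rewrite -speed_chart//.
    by apply: geodesic_on_derivable geo _; near: s; exact: open_nbhs_nbhs.
  by near: s; exact: curve_chart_dom_nbhs.
refine (is_derive_eq D _).
have Gsym := gram_sym cgt.
rewrite (form_sym (derive1n 2 _ t) _ Gsym) (geodesic_lowered _ geo Jt cgt); field.
Unshelve. all: by end_near. Qed.

Lemma geodesic_constant_speed (a b : R) gamma : geodesic a b gamma ->
  forall s t, a <= s <= b -> a <= t <= b ->
  tnorm (gamma s) (velocity gamma s) = tnorm (gamma t) (velocity gamma t).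
Proof.
move=> [e e0 geo].
pose N s := tnorm (gamma s) (velocity gamma s).
have N0 u : 0 <= N u by exact: sqrtr_ge0.
have dN u : a <= u <= b -> is_derive u 1 (fun s => N s ^+ 2) 0.
  move=> /andP[au ub]; apply: geodesic_speed_derive geo _; first exact: itv_open.
  rewrite /= in_itv/=; apply/andP; split.
    by rewrite ltrBlDr (le_lt_trans au)// ltrDl.
  by rewrite (le_lt_trans ub)// ltrDl.
suff H s t : a <= s <= b -> a <= t <= b -> s <= t -> N s = N t.
  move=> s t sab tab; have [st|/ltW ts] := leP s t; first exact: H.
  by apply/esym; exact: H.
clearbody N => /andP[a_s sb] /andP[a_t tb] st; apply/eqP.
rewrite -(@eqrXn2 R 2)// eq_sym -subr_eq0 -normr_le0 -(mul0r (t - s)).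
apply: (@derive_bound _ (fun u => N u ^+ 2) (cst 0)) => //.
  by move=> u /andP[su ut]; apply: dN; rewrite (le_trans a_s su) (le_trans ut tb).
by move=> u _ /=; rewrite normr0.
Qed.

End GeodesicEquation.

(** * Lengths of curves and upper bounds on the distance *)

Section PathLength.
Context {R : realType} {m : nat} {M : riemannian R m}.
Implicit Types (c p q : M) (gamma : R -> M) (z dz : R -> 'rV[R]_m).

Lemma curve_length_ge0 gamma (a b : R) : 0 <= curve_length gamma a b.
Proof. by apply: Rintegral_ge0 => t _; exact: sqrtr_ge0. Qed.

Lemma piecewise_C1_ge0 p q l : piecewise_C1 p q l -> 0 <= l.
Proof. by elim=> // *; rewrite addr_ge0// curve_length_ge0. Qed.

Lemma rdist_le p q l : piecewise_C1 p q l -> rdist p q <= l.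
Proof.
by move=> pl; apply: ge_inf => //; exists 0 => x; exact: piecewise_C1_ge0.
Qed.

Lemma rdist_ge0 p q : 0 <= rdist p q.
Proof.
(* If no curve joins the points, [rdist] is the infimum of the empty set, which is [0] by
   convention. *)
rewrite /rdist; have [->|/set0P ne] := eqVneq [set l | piecewise_C1 p q l] set0.
  by rewrite inf0.
by apply: lb_le_inf => // l; exact: piecewise_C1_ge0.
Qed.

Lemma geodesic_length gamma (a b : R) : a <= b -> geodesic a b gamma ->
  curve_length gamma a b = tnorm (gamma a) (velocity gamma a) * (b - a).
Proof.
move=> ab geo; rewrite /curve_length.
under eq_Rintegral => t.
  rewrite inE/= in_itv/= => tab.
  rewrite (geodesic_constant_speed geo tab (_ : a <= a <= b)) ?lexx ?ab//.
  over.
rewrite Rintegral_cst//= lebesgue_measure_itv/= lte_fin; congr (_ * _).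
by move: ab; rewrite le_eqVlt => /predU1P[->|->]; rewrite ?ltxx ?subrr.
Qed.

Lemma geodesic_path p l gamma (t : R) : 0 <= t -> geodesic 0 t gamma ->
  piecewise_C1 p (gamma 0) l ->
  piecewise_C1 p (gamma t) (l + t * tnorm (gamma 0) (velocity gamma 0)).
Proof.
move=> t0 geo pl; rewrite mulrC -[t in _ * t]subr0 -geodesic_length//.
have [e e0 [gC2 _]] := geo.
by apply: piecewise_C1_step pl t0 e0 (curve_Ck_le gC2) _.
Qed.

Lemma chart_invK c x : (chart c @` chart_dom c) x -> chart c (chart_inv c x) = x.
Proof. by move=> [p cp <-]; rewrite chartK. Qed.

Lemma chart_inv_dom c x : (chart c @` chart_dom c) x -> chart_dom c (chart_inv c x).
Proof. by move=> [p cp <-]; rewrite chartK. Qed.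

Lemma derive_real (V : normedModType R) (f : R -> V) (t v : R) :
  derivable f t 1 -> 'D_v f t = v *: 'D_1 f t.
Proof.
move=> /derivable1_diffP df; rewrite !deriveE//.
by rewrite -linearZ/= [_ *: _]mulr1.
Qed.

Lemma chart_curve_C1 c z dz (J : set R) : open J ->
  (forall s, J s -> (chart c @` chart_dom c) (z s)) ->
  (forall s, J s -> is_derive s 1 z (dz s)) ->
  (forall s, J s -> {for s, continuous dz}) ->
  curve_Ck 1 J (chart_inv c \o z).
Proof.
move=> Jo cz zdz cdz.
have cz0 s : J s -> {for s, continuous (chart_inv c \o z)}.
  move=> Js; apply: continuous_comp; first exact: is_derive1_continuous (zdz _ Js).
  by have [p cp <-] := cz _ Js; exact: chart_inv_continuous.
split => // c'.
have comp s : J s -> chart_dom c' (chart_inv c (z s)) ->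
    is_derive s 1 (chart c' \o (chart_inv c \o z))
      ('D_(dz s) (chart c' \o chart_inv c) (z s)).
  move=> Js c's; have [dtau _] := transition_C1 (chart_inv_dom (cz _ Js)) c's.
  rewrite chart_invK in dtau; last exact: cz.
  exact: is_derive_comp_diff dtau (zdz _ Js).
split=> [s [Js c's]|v s [Js c's]].
  by have [D _] := comp _ Js c's; exact/derivable1_diffP.
have [dtau ctau] := transition_C1 (chart_inv_dom (cz _ Js)) c's.
rewrite chart_invK in dtau ctau; last exact: cz.
(* [D] is the derivative near [s] by the chain rule. The expansion on the basis separates the moving
   direction [dz u] from the partial derivatives, as the transition maps give continuity of
   derivatives in a fixed direction. *)
pose D u := v *: \sum_j dz u 0 j *: 'D_(delta_mx 0 j) (chart c' \o chart_inv c) (z u).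
have near_D : \forall u \near s, D u = 'D_v (chart c' \o (chart_inv c \o z)) u.
  near=> u.
  have Ju : J u by near: u; exact: open_nbhs_nbhs.
  have c'u : chart_dom c' (chart_inv c (z u)).
    by near: u; exact: (curve_chart_dom_nbhs (cz0 _ Js) c's).
  have [du Du] := comp _ Ju c'u.
  have [dtu _] := transition_C1 (chart_inv_dom (cz _ Ju)) c'u.
  rewrite chart_invK in dtu; last exact: cz.
  by rewrite derive_real// Du derive_basis.
rewrite /prop_for/continuous_at -(nbhs_singleton near_D).
apply: cvg_trans (near_eq_cvg near_D) _.
apply: cvgZl_tmp; apply: cvg_big => [|j _]; first exact: add_continuous.
apply: cvgZ.
  apply: (@continuous_comp _ _ _ dz (fun w : 'rV[R]_m => w 0 j)); first exact: cdz.
  exact: coord_continuous.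
apply: (@continuous_comp _ _ _ z ('D_(delta_mx 0 j) (chart c' \o chart_inv c))).
  exact: is_derive1_continuous (zdz _ Js).
exact: ctau.
Unshelve. all: by end_near. Qed.

Lemma chart_curve_speed c z (s : R) d : curve_derivable (chart_inv c \o z) s ->
  (\forall u \near s, (chart c @` chart_dom c) (z u)) -> is_derive s 1 z d ->
  tnorm ((chart_inv c \o z) s) (velocity (chart_inv c \o z) s) ^+ 2 =
  form (gram c (z s)) d d.
Proof.
move=> dz cz zd; have czs := nbhs_singleton cz.
have cs : chart_dom c ((chart_inv c \o z) s) by exact: chart_inv_dom.
rewrite (speed_chart dz cs) /= chart_invK//.
suff -> : derive1 (chart c \o (chart_inv c \o z)) s = d by [].
rewrite derive1E.
suff [] : is_derive s 1 (chart c \o (chart_inv c \o z)) d by [].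
apply: near_eq_is_derive zd.
by near=> u; rewrite /= chart_invK//; near: u.
Unshelve. all: by end_near. Qed.

(** An explicit majorant [dpsi] of the speed is integrated in place of the speed itself. The
    conclusion extends an arbitrary path instead of bounding [rdist], so that pieces can be
    concatenated; the margin [e] provides the open interval required by [curve_Ck]. *)
Lemma chart_path c z dz (e : R) (psi dpsi : R -> R) : 0 < e ->
  (forall s : R, - e < s < 1 + e -> (chart c @` chart_dom c) (z s)) ->
  (forall s : R, - e < s < 1 + e -> is_derive s 1 z (dz s)) ->
  (forall s : R, - e < s < 1 + e -> {for s, continuous dz}) ->
  (forall s : R, 0 <= s <= 1 -> is_derive s 1 psi (dpsi s)) ->
  (forall s : R, 0 <= s <= 1 -> {for s, continuous dpsi}) ->
  (forall s : R, 0 <= s <= 1 -> 0 <= dpsi s) ->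
  (forall s : R, 0 <= s <= 1 -> form (gram c (z s)) (dz s) (dz s) <= dpsi s ^+ 2) ->
  exists2 l', l' <= psi 1 - psi 0 & forall p l,
    piecewise_C1 p (chart_inv c (z 0)) l ->
    piecewise_C1 p (chart_inv c (z 1)) (l + l').
Proof.
move=> e0 cz zdz cdz psiE cdpsi dpsi0 speed.
have Jo : open `]0 - e, 1 + e[%classic by exact: itv_open.
have JE s : `]0 - e, 1 + e[%classic s -> - e < s < 1 + e by rewrite /= in_itv/= sub0r.
have C1 : curve_Ck 1 `]0 - e, 1 + e[ (chart_inv c \o z).
  by apply: (@chart_curve_C1 _ _ dz) => // s /JE; [exact: cz|exact: zdz|exact: cdz].
exists (curve_length (chart_inv c \o z) 0 1); last first.
  by move=> p l pl; apply: piecewise_C1_step pl ler01 e0 C1 _.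
apply: (Rintegral_le_primitive ler01 psiE cdpsi) => s s01.
have Js : `]0 - e, 1 + e[%classic s.
  rewrite /= in_itv/= sub0r; case/andP : s01 => s0 s1; apply/andP; split.
    by rewrite (lt_le_trans _ s0)// oppr_lt0.
  by rewrite (le_lt_trans s1)// ltrDl.
apply/andP; split; first exact: sqrtr_ge0.
rewrite -ler_sqr; last 2 first.
- by rewrite nnegrE sqrtr_ge0.
- by rewrite nnegrE dpsi0.
have der := curve_C1_derivable C1 Js.
have img : \forall u \near s, (chart c @` chart_dom c) (z u).
  by near=> u; apply: cz; apply: JE; near: u; exact: open_nbhs_nbhs.
rewrite (chart_curve_speed der img (zdz _ (JE _ Js))); exact: speed.
Unshelve. all: by end_near. Qed.

End PathLength.

(** * Local estimates in a chart *)

Section LocalBounds.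
Context {R : realType} {m : nat} {M : riemannian R m}.
Implicit Types (c p q : M) (gamma : R -> M) (a b h x y : 'rV[R]_m).

Lemma dgram_bound c x h (C : R) : (chart c @` chart_dom c) x ->
  (forall l, `|dgram c x (delta_mx 0 l)| <= C) ->
  `|dgram c x h| <= m%:R * C * `|h|.
Proof.
move=> cx dC; rewrite dgram_basis//; apply: (le_trans (ler_norm_sum _ _ _)).
have -> : m%:R * C * `|h| = \sum_(l < m) `|h| * C.
  by rewrite sumr_const card_ord -mulr_natl; ring.
apply: ler_sum => l _; rewrite normrZ.
by apply: ler_pM => //; exact: normr_mx_entry.
Qed.

Definition ddgram c x h k : 'M[R]_m :=
  \matrix_(i, j) 'D_k ('D_h (fun y => gram c y i j : R^o)) x.

Lemma dgram_entry_differentiable c x h i j : (chart c @` chart_dom c) x ->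
  differentiable ('D_h (fun y => gram c y i j : R^o)) x.
Proof.
move=> cx; have [_ /(_ h)[+ _]] := @gram_smooth _ _ M c i j 2.
by apply.
Qed.

Lemma ddgram_continuous c x h k : (chart c @` chart_dom c) x ->
  {for x, continuous (fun y => ddgram c y h k)}.
Proof.
move=> cx; apply: continuous_mx => i j.
have -> : (fun y => ddgram c y h k i j) =
    'D_k ('D_h (fun y => gram c y i j : R^o)).
  by apply/funext => y; rewrite mxE.
have [_ /(_ h)[_ /(_ k)]] := @gram_smooth _ _ M c i j 2.
by apply.
Qed.

Lemma is_derive_dgram c (x : R -> 'rV[R]_m) h t d :
  (chart c @` chart_dom c) (x t) -> is_derive t 1 x d ->
  is_derive t 1 (fun s => dgram c (x s) h) (ddgram c (x t) h d).
Proof.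
move=> cx dx; apply/is_derive_mxP => i j; rewrite mxE.
have -> : (fun s => dgram c (x s) h i j) =
    'D_h (fun y => gram c y i j : R^o) \o x.
  by apply/funext => s; rewrite mxE.
exact: is_derive_comp_diff (dgram_entry_differentiable h i j cx) dx.
Qed.

Lemma ddgram_bound c x h k (C : R) : (chart c @` chart_dom c) x ->
  (forall l, `|ddgram c x h (delta_mx 0 l)| <= C) ->
  `|ddgram c x h k| <= m%:R * C * `|k|.
Proof.
move=> cx dC.
have -> : ddgram c x h k = \sum_l k 0 l *: ddgram c x h (delta_mx 0 l).
  apply/matrixP => i j; rewrite summxE mxE derive_basis.
    by apply: eq_bigr => l _; rewrite !mxE.
  exact: dgram_entry_differentiable.
apply: (le_trans (ler_norm_sum _ _ _)).
have -> : m%:R * C * `|k| = \sum_(l < m) `|k| * C.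
  by rewrite sumr_const card_ord -mulr_natl; ring.
apply: ler_sum => l _; rewrite normrZ.
by apply: ler_pM => //; exact: normr_mx_entry.
Qed.

Section Segment.
Context (c : M) (rho : R).
Hypothesis ball_img : forall x, `|x - chart c c| <= rho -> (chart c @` chart_dom c) x.

Lemma segment_ball x y s : `|x - chart c c| <= rho -> `|y - chart c c| <= rho ->
  0 <= s <= 1 -> `|x + s *: (y - x) - chart c c| <= rho.
Proof.
move=> xr yr /andP[s0 s1].
have -> : x + s *: (y - x) - chart c c =
    (1 - s) *: (x - chart c c) + s *: (y - chart c c).
  by apply/matrixP => i j; rewrite !mxE; ring.
rewrite (le_trans (ler_normD _ _))// !normrZ (ger0_norm s0) ger0_norm ?subr_ge0//.
have : (1 - s) * `|x - chart c c| <= (1 - s) * rho by rewrite ler_wpM2l// subr_ge0.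
have : s * `|y - chart c c| <= s * rho by rewrite ler_wpM2l.
lra.
Qed.

Lemma gram_segment_lipschitz x y (C : R) : 0 <= C ->
  `|x - chart c c| <= rho -> `|y - chart c c| <= rho ->
  (forall z h, `|z - chart c c| <= rho -> `|dgram c z h| <= C * `|h|) ->
  `|gram c y - gram c x| <= C * `|y - x|.
Proof.
move=> C0 xr yr dC.
have CC0 : 0 <= C * `|y - x| by rewrite mulr_ge0.
have := @derive_bound_mx R m m (fun s => gram c (x + s *: (y - x)))
  (fun s => dgram c (x + s *: (y - x)) (y - x)) 0 1 _ ler01 CC0.
rewrite scale0r addr0 scale1r subrKC subr0 mulr1; apply => s s01.
  apply: (@is_derive_gram _ _ _ c (fun s => x + s *: (y - x))).
    exact/ball_img/segment_ball.
  exact: is_derive_line.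
exact/dC/segment_ball.
Qed.

Lemma dgram_segment_lipschitz x y h (C : R) : 0 <= C ->
  `|x - chart c c| <= rho -> `|y - chart c c| <= rho ->
  (forall z k, `|z - chart c c| <= rho -> `|ddgram c z h k| <= C * `|k|) ->
  `|dgram c y h - dgram c x h| <= C * `|y - x|.
Proof.
move=> C0 xr yr dC.
have CC0 : 0 <= C * `|y - x| by rewrite mulr_ge0.
have := @derive_bound_mx R m m (fun s => dgram c (x + s *: (y - x)) h)
  (fun s => ddgram c (x + s *: (y - x)) h (y - x)) 0 1 _ ler01 CC0.
rewrite scale0r addr0 scale1r subrKC subr0 mulr1; apply => s s01.
  apply: (@is_derive_dgram c (fun s => x + s *: (y - x))).
    exact/ball_img/segment_ball.
  exact: is_derive_line.
exact/dC/segment_ball.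
Qed.

(** Mean value inequality for the remainder along the segment: its derivative is a difference of two
    values of [dgram], already of order [|y - x| ^+ 2]. The linear term is written [0 + s *: _] to
    match [is_derive_line]. *)
Lemma gram_segment_taylor x y (C : R) : 0 <= C ->
  `|x - chart c c| <= rho -> `|y - chart c c| <= rho ->
  (forall z h, `|z - chart c c| <= rho ->
     `|dgram c z h - dgram c x h| <= C * `|z - x| * `|h|) ->
  `|gram c y - gram c x - dgram c x (y - x)| <= C * `|y - x| ^+ 2.
Proof.
move=> C0 xr yr dC.
have CC0 : 0 <= C * `|y - x| ^+ 2 by rewrite mulr_ge0// sqr_ge0.
have := @derive_bound_mx R m m
  (fun s => gram c (x + s *: (y - x)) - (0 + s *: dgram c x (y - x)))
  (fun s => dgram c (x + s *: (y - x)) (y - x) - dgram c x (y - x)) 0 1 _ ler01 CC0.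
rewrite !scale0r !addr0 !scale1r subrKC !add0r !subr0 mulr1 addrAC.
apply => s s01.
  apply: is_deriveB; last exact: is_derive_line.
  apply: (@is_derive_gram _ _ _ c (fun s => x + s *: (y - x))).
    exact/ball_img/segment_ball.
  exact: is_derive_line.
apply: (le_trans (dC _ _ (segment_ball xr yr s01))).
rewrite expr2 mulrA ler_wpM2r// ler_wpM2l// addrC addKr normrZ.
by case/andP: s01 => s0 s1; rewrite ger0_norm// ler_piMl.
Qed.

End Segment.

(** The regularity of the metric is summarized by [rho], [lam] and [K] for all later estimates. The
    Taylor remainder stands for a bound on the second derivatives of the metric. *)
Definition chart_bounds c (rho lam K : R) : Prop :=
  [/\ 0 < rho, 0 < lam, 0 < K & forall x, `|x - chart c c| <= rho ->
   [/\ (chart c @` chart_dom c) x,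
       forall a, lam * `|a| ^+ 2 <= form (gram c x) a a,
       `|gram c x| <= K,
       forall h, `|dgram c x h| <= K * `|h| &
       forall y, `|y - chart c c| <= rho ->
         `|gram c y - gram c x| <= K * `|y - x| /\
         `|gram c y - gram c x - dgram c x (y - x)| <= K * `|y - x| ^+ 2]].

Lemma cvg_norm_bound (T : topologicalType) (V : normedModType R) (f : T -> V) (x : T) :
  {for x, continuous f} -> \forall y \near x, `|f y| <= `|f x| + 1.
Proof.
move=> /cvgrPdist_le/(_ 1 ltr01) fx; near=> y.
rewrite -lerBlDl (le_trans (lerB_dist _ _))// distrC.
by near: y.
Unshelve. all: by end_near. Qed.

(** Continuity at the center bounds the metric and its first two derivatives in basis directions on
    a small ball; linearity in the direction and the mean value inequality give the rest. *)
Lemma chart_bounds_exist c : exists rho lam K, chart_bounds c rho lam K.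
Proof.
pose x0 := chart c c.
have cx0 : (chart c @` chart_dom c) x0 by exists c => //; exact: chart_dom_center.
have [lam0 lam0_gt0 coer] := posdef_coercive (gram_posdef (chart_dom_center c)).
have m1 : 0 < m%:R ^+ 2 + 1 :> R by rewrite ltr_pwDr// sqr_ge0.
(* By [form_bound], changing the Gram matrix by [eps] changes the form by at most
   [lam0 / 2 * |a| ^+ 2], so half of the coercivity survives. The [+ 1] avoids a zero denominator in
   dimension [0]. *)
pose eps := lam0 / 2 / (m%:R ^+ 2 + 1).
have eps0 : 0 < eps by rewrite !divr_gt0.
pose K1 := \sum_l (`|dgram c x0 (delta_mx 0 l)| + 1).
pose K2 := \sum_l \sum_k (`|ddgram c x0 (delta_mx 0 l) (delta_mx 0 k)| + 1).
have : \forall x \near x0, [/\ (chart c @` chart_dom c) x,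
    `|gram c x0 - gram c x| <= eps,
    forall l, `|dgram c x (delta_mx 0 l)| <= `|dgram c x0 (delta_mx 0 l)| + 1 &
    forall l k, `|ddgram c x (delta_mx 0 l) (delta_mx 0 k)| <=
      `|ddgram c x0 (delta_mx 0 l) (delta_mx 0 k)| + 1].
  near=> x; split.
  - by near: x; exact: chart_img_nbhs.
  - by near: x; have /cvgrPdist_le := gram_continuous cx0; apply.
  - near: x; apply: filter_forall => l.
    exact: (cvg_norm_bound (dgram_continuous cx0)).
  - near: x; apply: filter_forall => l; apply: filter_forall => k.
    exact: (cvg_norm_bound (ddgram_continuous cx0)).
move=> /nbhs_ballP[rho0/= rho0_gt0 ballP].
(* Half the radius places the closed ball inside the open one. *)
pose rho := rho0 / 2.
have inball x : `|x - x0| <= rho -> ball x0 rho0 x.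
  move=> xr; rewrite -ball_normE /ball_/= distrC (le_lt_trans xr)//.
  by rewrite /rho ltr_pdivrMr// ltr_pMr// ltr1n.
have img x : `|x - x0| <= rho -> (chart c @` chart_dom c) x.
  by move=> xr; have [] := ballP x (inball x xr).
have nrm1 (V : normedModType R) (u : V) : 0 <= `|u| + 1 by rewrite addr_ge0.
have dgK1 l : `|dgram c x0 (delta_mx 0 l)| + 1 <= K1.
  by apply: (@ler_sum_term _ _ (fun l => `|dgram c x0 (delta_mx 0 l)| + 1)) => j;
    exact: nrm1.
have ddgK2 l k : `|ddgram c x0 (delta_mx 0 l) (delta_mx 0 k)| + 1 <= K2.
  have le1 : `|ddgram c x0 (delta_mx 0 l) (delta_mx 0 k)| + 1 <=
      \sum_k (`|ddgram c x0 (delta_mx 0 l) (delta_mx 0 k)| + 1).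
    by apply: (@ler_sum_term _ _
      (fun k => `|ddgram c x0 (delta_mx 0 l) (delta_mx 0 k)| + 1)) => j; exact: nrm1.
  apply: (le_trans le1); apply: (@ler_sum_term _ _
    (fun l => \sum_k (`|ddgram c x0 (delta_mx 0 l) (delta_mx 0 k)| + 1))) => j.
  by apply: sumr_ge0 => i _; exact: nrm1.
have K10 : 0 <= K1 by apply: sumr_ge0 => l _; exact: nrm1.
have K20 : 0 <= K2.
  by apply: sumr_ge0 => l _; apply: sumr_ge0 => k _; exact: nrm1.
have dg z h : `|z - x0| <= rho -> `|dgram c z h| <= m%:R * K1 * `|h|.
  move=> zr; have [cz _ dl _] := ballP z (inball z zr).
  by apply: (dgram_bound _ cz) => l; exact: (le_trans (dl l) (dgK1 l)).
have ddg z l k : `|z - x0| <= rho ->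
    `|ddgram c z (delta_mx 0 l) k| <= m%:R * K2 * `|k|.
  move=> zr; have [cz _ _ dl] := ballP z (inball z zr).
  by apply: (ddgram_bound _ cz) => j; exact: (le_trans (dl l j) (ddgK2 l j)).
clearbody K1 K2.
have dgL x z h : `|x - x0| <= rho -> `|z - x0| <= rho ->
    `|dgram c z h - dgram c x h| <= m%:R * (m%:R * K2) * `|z - x| * `|h|.
  move=> xr zr; rewrite (dgram_basis _ (img _ zr)) (dgram_basis _ (img _ xr)).
  rewrite -sumrB; apply: (le_trans (ler_norm_sum _ _ _)).
  have -> : m%:R * (m%:R * K2) * `|z - x| * `|h| =
      \sum_(l < m) `|h| * (m%:R * K2 * `|z - x|).
    by rewrite sumr_const card_ord -mulr_natl; ring.
  apply: ler_sum => l _; rewrite -scalerBr normrZ.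
  apply: ler_pM => //; first exact: normr_mx_entry.
  apply: (dgram_segment_lipschitz img) => //; first by rewrite mulr_ge0.
  by move=> y k; exact: ddg.
pose K := `|gram c x0| + eps + m%:R * K1 + m%:R * (m%:R * K2).
have K0 : 0 < K.
  by rewrite /K -addrA -addrA addrCA ltr_pwDl// addr_ge0// addr_ge0// ?mulr_ge0.
have g0 := normr_ge0 (gram c x0).
have mK1 : 0 <= m%:R * K1 by rewrite mulr_ge0.
have mK2 : 0 <= m%:R * (m%:R * K2) by rewrite !mulr_ge0.
have dgK x h : `|x - x0| <= rho -> `|dgram c x h| <= K * `|h|.
  by move=> xr; rewrite (le_trans (dg _ _ xr))// ler_wpM2r// /K; lra.
exists rho, (lam0 / 2), K; split => //; try by rewrite divr_gt0.
move=> x xr; have [cx gx _ _] := ballP x (inball x xr); split => //.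
- move=> a; have -> : gram c x = gram c x0 - (gram c x0 - gram c x).
    by rewrite subKr.
  rewrite formBm.
  have : `|form (gram c x0 - gram c x) a a| <= lam0 / 2 * `|a| ^+ 2.
    apply: (le_trans (form_bound _ _ _)); rewrite expr2 !mulrA.
    do 2 (apply: ler_wpM2r => //).
    apply: (@le_trans _ _ ((m%:R ^+ 2 + 1) * eps)); last first.
      by rewrite /eps mulrC divfK// gt_eqF.
    by apply: ler_pM => //; rewrite ?sqr_ge0// lerDl.
  have := coer a; rewrite -/x0 ler_norml => ? /andP[? ?]; lra.
- have : `|gram c x| <= `|gram c x0| + `|gram c x0 - gram c x|.
    by rewrite -{1}(subKr (gram c x0) (gram c x)) ler_normB.
  by rewrite /K; lra.
- by move=> h; exact: dgK.
- move=> y yr; split.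
    by apply: (gram_segment_lipschitz img) => //; exact: ltW.
  apply: (gram_segment_taylor img) => //; first exact: ltW.
  move=> z h zr; rewrite (le_trans (dgL _ _ _ xr zr))//.
  by rewrite ler_wpM2r// ler_wpM2r// /K; lra.
Unshelve. all: by end_near. Qed.

End LocalBounds.

(** * Curves of bounded speed remain in a chart *)

Section Escape.
Context {R : realType} {m : nat} {M : riemannian R m}.
Implicit Types (c p q : M) (gamma : R -> M).

(** The image of a compact coordinate ball is compact, hence closed since the manifold is Hausdorff.
    This prevents a curve from leaving the chart domain at a limit time while its coordinates stay
    bounded. *)
Lemma chart_ball_closed c rho lam K (r : R) : chart_bounds c rho lam K -> r <= rho ->
  closed (chart_inv c @` [set x : 'rV[R]_m | `|x - chart c c| <= r] : set M).
Proof.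
move=> [_ _ _ bnd] rrho; apply: compact_closed; first exact: mpoint_hausdorff.
apply: continuous_compact.
  apply: within_continuous_for => x /= xr.
  have [[p cp <-] _ _ _ _] := bnd x (le_trans xr rrho).
  exact: chart_inv_continuous.
have -> : [set x : 'rV[R]_m | `|x - chart c c| <= r] = closed_ball_ Num.norm (chart c c) r.
  by apply/seteqP; split=> x; rewrite /closed_ball_/= distrC.
apply: bounded_closed_compact; last exact: closed_closed_ball_.
exists (`|chart c c| + r); split; first exact: num_real.
move=> x xr y; rewrite /closed_ball_/= => yr.
rewrite ltW// (le_lt_trans _ xr)// -[y](subrKC (chart c c)).
by rewrite (le_trans (ler_normD _ _))// lerD2l distrC.
Qed.

Lemma chart_ball_nbhs c q (r : R) : chart_dom c q -> `|chart c q - chart c c| < r ->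
  \forall q' \near q, chart_dom c q' /\ `|chart c q' - chart c c| < r.
Proof.
move=> cq qr; near=> q'; split; first by near: q'; exact: chart_dom_nbhs.
have : `|chart c q - chart c q'| < r - `|chart c q - chart c c|.
  near: q'; have /cvgrPdist_lt := chart_continuous cq; apply.
  by rewrite subr_gt0.
have := ler_distD (chart c q) (chart c q') (chart c c).
rewrite (distrC (chart c q') (chart c q)); lra.
Unshelve. all: by end_near. Qed.

(** Inside the coordinate ball, coercivity turns the bound on the metric speed into [|d t| <= V], so
    up to a first exit the coordinates move by at most [V * (b - a)], which falls short of the
    boundary. *)
Lemma curve_stays c rho lam K gamma (d : R -> 'rV[R]_m) (a b V : R) :
  chart_bounds c rho lam K -> a <= b -> 0 <= V ->
  (forall t, a <= t <= b -> {for t, continuous gamma}) ->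
  (forall t, a <= t <= b -> chart_dom c (gamma t) ->
     is_derive t 1 (chart c \o gamma) (d t)) ->
  (forall t, a <= t <= b -> chart_dom c (gamma t) ->
     form (gram c (chart c (gamma t))) (d t) (d t) <= lam * V ^+ 2) ->
  chart_dom c (gamma a) -> `|chart c (gamma a) - chart c c| + V * (b - a) < rho ->
  forall t, a <= t <= b -> chart_dom c (gamma t) /\
    `|chart c (gamma t) - chart c (gamma a)| <= V * (t - a).
Proof.
move=> bnd ab V0 cg dg sg cga far.
have [rho0 lam0 K0 B] := bnd.
pose good q := chart_dom c q /\ `|chart c q - chart c c| < rho.
have dV t : a <= t <= b -> good (gamma t) -> `|d t| <= V.
  move=> tab [cgt /ltW /B [_ /(_ (d t)) low _ _ _]].
  rewrite -ler_sqr ?nnegrE// -(ler_pM2l lam0).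
  by apply: (le_trans low); exact: sg.
have lip t : a <= t <= b -> (forall s, a <= s <= t -> good (gamma s)) ->
    `|chart c (gamma t) - chart c (gamma a)| <= V * (t - a).
  move=> /andP[at_ tb] gd.
  apply: (@derive_bound_mx _ _ _ (chart c \o gamma) d) => // s /andP[as_ st].
    apply: dg; first by rewrite as_ (le_trans st tb).
    by have [] := gd s; rewrite ?as_.
  by apply: dV; [rewrite as_ (le_trans st tb)|apply: gd; rewrite as_].
pose r1 := `|chart c (gamma a) - chart c c| + V * (b - a).
have near_center t : a <= t <= b ->
    `|chart c (gamma t) - chart c (gamma a)| <= V * (t - a) ->
    `|chart c (gamma t) - chart c c| <= r1.
  move=> /andP[at_ tb] h.
  have := ler_distD (chart c (gamma a)) (chart c (gamma t)) (chart c c).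
  have : V * (t - a) <= V * (b - a) by rewrite ler_wpM2l// lerD2r.
  rewrite /r1; lra.
suff allgood t : a <= t <= b -> good (gamma t).
  move=> t tab; split; first by have [] := allgood t tab.
  apply: lip => // s /andP[as_ st]; apply: allgood; rewrite as_ (le_trans st)//.
  by case/andP: tab.
(* [T]: first exit time from the chart ball; by [lip] the curve is still strictly
   inside at [T] *)
pose Bad := [set t | a <= t <= b /\ ~ good (gamma t)].
apply: contrapT => /not_implyP[tab badt].
have Badlb : has_lbound Bad by exists a => s [/andP[]].
have Badi : has_inf Bad by split => //; exists t; split.
pose T := inf Bad.
have aT : a <= T.
  by apply: lb_le_inf; [exists t|move=> s [/andP[]]].
have Tb : T <= b.
  by apply: (@le_trans _ _ t); [apply: ge_inf|case/andP: tab].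
have before s : a <= s -> s < T -> good (gamma s).
  move=> as_ sT; apply: contrapT => bs.
  have : T <= s by apply: ge_inf => //; split=> //; rewrite as_ (le_trans (ltW sT)).
  by rewrite leNgt sT.
(* [C] contains the curve before [T] and is closed in the manifold, so it contains [gamma T]; this
   puts [gamma T] in the chart domain. *)
pose C := chart_inv c @` [set x : 'rV[R]_m | `|x - chart c c| <= r1] : set M.
have Cgood q : C q -> good q.
  move=> [x /= xr <-].
  have [[p cp px] _ _ _ _] : _ := B x (le_trans xr (ltW far)).
  by rewrite -px chartK// in xr *; split => //; exact: le_lt_trans xr far.
have Cs s : a <= s -> (forall u, a <= u <= s -> good (gamma u)) -> s <= b -> C (gamma s).
  move=> as_ gs sb; exists (chart c (gamma s)).
    by apply: near_center; [rewrite as_|apply: lip => //; rewrite as_].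
  by rewrite chartK//; have [] := gs s; rewrite ?as_ ?lexx.
have CT : C (gamma T).
  have [aT'|] := ltP a T; last first.
    move=> Ta; have -> : T = a by apply/eqP; rewrite eq_le Ta aT.
    exists (chart c (gamma a)); last by rewrite chartK.
    by rewrite /r1/= lerDl mulr_ge0// subr_ge0.
  have Tab : a <= T <= b by rewrite aT Tb.
  apply: contrapT => nCT.
  have oC : open (~` C) by apply: closed_openC; exact: (chart_ball_closed bnd (ltW far)).
  have : \forall s \near T, (~` C) (gamma s).
    by apply: (cg T Tab); apply: open_nbhs_nbhs.
  move=> /nbhs_ballP[e /= e0 eC].
  (* A time before [T], not before [a], and close enough to [T] for the curve to lie outside [C]. *)
  pose s := Num.max a (T - e / 2).
  have sT : s < T by rewrite gt_max aT'/= ltrBlDr ltrDl divr_gt0.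
  have as_ : a <= s by rewrite le_max lexx.
  apply: (eC s); last first.
    apply: Cs => //; last by rewrite (le_trans (ltW sT)).
    by move=> u /andP[au us]; apply: before => //; exact: le_lt_trans us sT.
  rewrite /ball/= ger0_norm ?subr_ge0 ?(ltW sT)// ltrBlDr addrC -ltrBlDr.
  by rewrite lt_max orbC ler_ltD// ltrN2 ltr_pdivrMr// ltr_pMr// ltr1n.
have [cT Tr] := Cgood _ CT.
have : \forall s \near T, good (gamma s).
  have Tab : a <= T <= b by rewrite aT Tb.
  by apply: (cg T Tab); exact: chart_ball_nbhs.
move=> /nbhs_ballP[e /= e0 eT].
have [s [sab sbad] sTe] := inf_adherent e0 Badi.
apply: (sbad); apply: eT; rewrite /ball/= distrC ger0_norm.
  by rewrite ltrBlDl.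
by rewrite subr_ge0; apply: ge_inf.
Qed.

(** Time reversal, for a curve whose known end is the final one: the minimal geodesics considered
    below arrive at the center of the chart. *)
Lemma curve_stays_rev c rho lam K gamma (d : R -> 'rV[R]_m) (a b V : R) :
  chart_bounds c rho lam K -> a <= b -> 0 <= V ->
  (forall t, a <= t <= b -> {for t, continuous gamma}) ->
  (forall t, a <= t <= b -> chart_dom c (gamma t) ->
     is_derive t 1 (chart c \o gamma) (d t)) ->
  (forall t, a <= t <= b -> chart_dom c (gamma t) ->
     form (gram c (chart c (gamma t))) (d t) (d t) <= lam * V ^+ 2) ->
  chart_dom c (gamma b) -> `|chart c (gamma b) - chart c c| + V * (b - a) < rho ->
  forall t, a <= t <= b -> chart_dom c (gamma t) /\
    `|chart c (gamma t) - chart c (gamma b)| <= V * (b - t).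
Proof.
move=> bnd ab V0 cg dg sg cgb far t tab.
pose flip (s : R) := a + b - s.
have flipK s : flip (flip s) = s by rewrite /flip; lra.
have flip_itv s : a <= s <= b -> a <= flip s <= b.
  by rewrite /flip => /andP[? ?]; apply/andP; split; lra.
have flip_a : flip a = b by rewrite /flip; lra.
have dflip (s : R) : is_derive s 1 flip (-1).
  have -> : flip = (fun u => (a + b) + u *: (-1)).
    by apply/funext => u; rewrite /flip /GRing.scale/=; lra.
  exact: is_derive_line.
have cgf s : a <= s <= b -> {for s, continuous (gamma \o flip)}.
  move=> sab; apply: (@continuous_comp _ _ _ flip gamma).
    exact: is_derive1_continuous (dflip s).
  exact/cg/flip_itv.
have dgf s : a <= s <= b -> chart_dom c ((gamma \o flip) s) ->
    is_derive s 1 (chart c \o (gamma \o flip)) (- d (flip s)).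
  move=> sab cs; have [dx dxE] := dg _ (flip_itv _ sab) cs.
  have -> : - d (flip s) = 'D_(-1) (chart c \o gamma) (flip s).
    by rewrite (derive_real (-1) dx) dxE scaleN1r.
  have dx' : differentiable (chart c \o gamma) (flip s) by apply/derivable1_diffP.
  exact: (is_derive_comp_diff dx' (dflip s)).
have sgf s : a <= s <= b -> chart_dom c ((gamma \o flip) s) ->
    form (gram c (chart c ((gamma \o flip) s))) (- d (flip s)) (- d (flip s))
      <= lam * V ^+ 2.
  by move=> sab cs; rewrite formNl formNr opprK; exact/sg/cs/flip_itv.
rewrite -{1}flip_a in far; rewrite -flip_a in cgb.
have [] := curve_stays bnd ab V0 cgf dgf sgf cgb far (flip_itv _ tab).
rewrite /= flipK flip_a => ct le; split => //.
by apply: (le_trans le); rewrite le_eqVlt; apply/orP; left; apply/eqP; rewrite /flip; ring.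
Qed.

End Escape.

(** * Geodesics and energy estimates in a chart *)

Section LocalGeometry.
Context {R : realType} {m : nat} {M : riemannian R m}.
Implicit Types (c p q : M) (gamma : R -> M).

Lemma geodesic_derivable gamma (a b t : R) : geodesic a b gamma -> a <= t <= b ->
  curve_derivable gamma t.
Proof.
move=> [e e0 geo] /andP[at_ tb]; apply: geodesic_on_derivable geo _.
rewrite /= in_itv/=; apply/andP; split.
  by rewrite ltrBlDr (le_lt_trans at_)// ltrDl.
by rewrite (le_lt_trans tb)// ltrDl.
Qed.

Lemma geodesic_chart_speed c gamma (a b t : R) : geodesic a b gamma ->
  a <= t <= b -> chart_dom c (gamma t) ->
  form (gram c (chart c (gamma t))) (derive1 (chart c \o gamma) t)
                                    (derive1 (chart c \o gamma) t) =
  tnorm (gamma a) (velocity gamma a) ^+ 2.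
Proof.
move=> geo tab cgt; rewrite -(speed_chart (geodesic_derivable geo tab) cgt).
have aab : a <= a <= b by case/andP: tab => at_ tb; rewrite lexx (le_trans at_).
by rewrite (geodesic_constant_speed geo tab aab).
Qed.

(* The energy density of the curve [x s + (1 - s) w] to first order in [w], with
   [v = x' s], [sg = 1 - s] and [dG] the derivative of the metric along [w]. *)
Lemma form_perturb (G0 G1 dG : 'M[R]_m) (v w : 'rV[R]_m) (sg K : R) :
  G0^T = G0 -> 0 <= sg <= 1 -> 0 <= K -> `|v| <= 1 -> `|w| <= 1 ->
  `|G0| <= K -> `|dG| <= K * `|w| -> `|G1 - G0 - sg *: dG| <= K * `|w| ^+ 2 ->
  form G1 (v - w) (v - w) <=
  form G0 v v + 2 * (- form G0 w v + sg * (2^-1 * form dG v v)) +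
  8 * (m%:R ^+ 2 * K) * `|w| ^+ 2.
Proof.
move=> Gsym sg01 K0 v1 w1 G0K dGK EK.
have -> : G1 = G0 + sg *: dG + (G1 - G0 - sg *: dG).
  by rewrite -[G1 - G0 - _]addrA -opprD subrKC.
set E := G1 - G0 - _ in EK *; clearbody E.
set C := m%:R ^+ 2 * K.
have C0 : 0 <= C by rewrite mulr_ge0 ?sqr_ge0.
have bound (A : 'M[R]_m) (a b : 'rV[R]_m) (k : R) :
    0 <= k -> `|A| * `|a| * `|b| <= k * (K * `|w| ^+ 2) ->
    `|form A a b| <= k * (C * `|w| ^+ 2).
  move=> k0 h; apply: (le_trans (form_bound _ _ _)).
  have -> : k * (C * `|w| ^+ 2) = m%:R ^+ 2 * (k * (K * `|w| ^+ 2)).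
    by rewrite /C; ring.
  have -> : m%:R ^+ 2 * `|A| * `|a| * `|b| = m%:R ^+ 2 * (`|A| * `|a| * `|b|).
    by ring.
  by rewrite ler_wpM2l ?sqr_ge0.
(* The constant [8] is spent as [1] for [form G0 w w], [3] for the three terms of [dG] that contain
   [w], and [4] for the remainder [E], since [|v - w| <= 2]. *)
have bww : `|form G0 w w| <= 1 * (C * `|w| ^+ 2).
  apply: bound => //; rewrite mul1r -mulrA -expr2.
  by rewrite ler_wpM2r ?sqr_ge0.
have dww (a b : 'rV[R]_m) : `|a| * `|b| <= `|w| ->
    `|form dG a b| <= 1 * (C * `|w| ^+ 2).
  move=> ab; apply: bound => //; rewrite mul1r expr2 mulrA -mulrA.
  by apply: ler_pM => //; rewrite mulr_ge0.
have b1 := dww v w (_ : `|v| * `|w| <= `|w|).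
have b2 := dww w v (_ : `|w| * `|v| <= `|w|).
have b3 := dww w w (_ : `|w| * `|w| <= `|w|).
have {}b1 := b1 (ler_piMl (normr_ge0 _) v1).
have {}b2 := b2 (ler_piMr (normr_ge0 _) v1).
have {}b3 := b3 (ler_piMr (normr_ge0 _) w1).
have b4 : `|form E (v - w) (v - w)| <= 4 * (C * `|w| ^+ 2).
  have vw : `|v - w| <= 2 by rewrite (le_trans (ler_normB _ _))//; lra.
  apply: bound => //; rewrite -mulrA mulrC.
  apply: ler_pM => //.
  by rewrite (_ : 4 = 2 * 2 :> R); [apply: ler_pM|ring].
rewrite !formDm formZm.
move: b1 b2 b3 b4 bww; set T := C * `|w| ^+ 2.
have -> : 8 * C * `|w| ^+ 2 = 8 * T by rewrite /T; ring.
rewrite !(formBl, formBr) (form_sym v w Gsym).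
set g1 := form G0 v v; set g2 := form G0 w v; set g3 := form G0 w w.
set d1 := form dG v v; set d2 := form dG v w; set d3 := form dG w v.
set d4 := form dG w w; set X := form E v v - _ - _.
rewrite !ler_norml !mul1r => /andP[? ?] /andP[? ?] /andP[? ?] /andP[? ?] /andP[? ?].
case/andP: sg01 => sg0 sg1.
have : sg * (- d2 - d3 + d4) <= 3 * T.
  apply: (@le_trans _ _ (sg * (3 * T))); first by rewrite ler_wpM2l//; lra.
  by rewrite ler_piMl//; lra.
lra.
Qed.

Section Bounds.
Variables (c : M) (rho lam K : R).
Hypothesis bnd : chart_bounds c rho lam K.

Let lam0 : 0 < lam. Proof. by case: bnd. Qed.

Lemma speed_sqrt (S : R) : lam * (S / Num.sqrt lam) ^+ 2 = S ^+ 2.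
Proof.
by rewrite expr_div_n sqr_sqrtr ?ltW// mulrC divfK// gt_eqF.
Qed.

Lemma geodesic_stays gamma (a b : R) : a <= b -> geodesic a b gamma ->
  let V := tnorm (gamma a) (velocity gamma a) / Num.sqrt lam in
  chart_dom c (gamma a) -> `|chart c (gamma a) - chart c c| + V * (b - a) < rho ->
  forall t, a <= t <= b -> chart_dom c (gamma t) /\
    `|chart c (gamma t) - chart c (gamma a)| <= V * (t - a).
Proof.
move=> ab geo V cga far.
have V0 : 0 <= V by rewrite divr_ge0// sqrtr_ge0.
apply: (curve_stays (d := derive1 (chart c \o gamma)) bnd ab V0 _ _ _ cga far).
- by move=> t /(geodesic_derivable geo)[].
- by move=> t /(geodesic_derivable geo); exact: curve_derivableP.
- by move=> t tab cgt; rewrite (geodesic_chart_speed geo tab cgt) speed_sqrt.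
Qed.

Lemma geodesic_stays_rev gamma (a b : R) : a <= b -> geodesic a b gamma ->
  let V := tnorm (gamma a) (velocity gamma a) / Num.sqrt lam in
  chart_dom c (gamma b) -> `|chart c (gamma b) - chart c c| + V * (b - a) < rho ->
  forall t, a <= t <= b -> chart_dom c (gamma t) /\
    `|chart c (gamma t) - chart c (gamma b)| <= V * (b - t).
Proof.
move=> ab geo V cgb far.
have V0 : 0 <= V by rewrite divr_ge0// sqrtr_ge0.
apply: (curve_stays_rev (d := derive1 (chart c \o gamma)) bnd ab V0 _ _ _ cgb far).
- by move=> t /(geodesic_derivable geo)[].
- by move=> t /(geodesic_derivable geo); exact: curve_derivableP.
- by move=> t tab cgt; rewrite (geodesic_chart_speed geo tab cgt) speed_sqrt.
Qed.

Lemma geodesic_chart_velocity gamma (a b t : R) : geodesic a b gamma ->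
  a <= t <= b -> chart_dom c (gamma t) -> `|chart c (gamma t) - chart c c| <= rho ->
  `|derive1 (chart c \o gamma) t| <=
  tnorm (gamma a) (velocity gamma a) / Num.sqrt lam.
Proof.
move=> geo tab cgt tr; have [_ _ _ /(_ _ tr)[_ coer _ _ _]] := bnd.
rewrite -ler_sqr ?nnegrE ?divr_ge0 ?sqrtr_ge0// -(ler_pM2l lam0) speed_sqrt.
by rewrite -(geodesic_chart_speed geo tab cgt); exact: coer.
Qed.

Lemma segment_path (x y : 'rV[R]_m) :
  `|x - chart c c| <= rho / 2 -> `|y - chart c c| <= rho / 2 ->
  exists2 l', l' <= Num.sqrt (m%:R ^+ 2 * K) * `|y - x| & forall p l,
    piecewise_C1 p (chart_inv c x) l -> piecewise_C1 p (chart_inv c y) (l + l').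
Proof.
move=> xr yr; have [rho0 _ K0 B] := bnd.
set A := Num.sqrt _ * _.
have A0 : 0 <= A by rewrite mulr_ge0 ?sqrtr_ge0.
(* The segment is prolonged past both ends to have an open parameter interval. There
   [|1 - s| + |s| <= 3 / 2], so endpoints within [rho / 2] keep it in the ball. *)
have inball (s : R) : - (4^-1) < s < 1 + 4^-1 ->
    `|x + s *: (y - x) - chart c c| <= rho.
  move=> /andP[s0 s1].
  have -> : x + s *: (y - x) - chart c c =
      (1 - s) *: (x - chart c c) + s *: (y - chart c c).
    by apply/matrixP => i j; rewrite !mxE; ring.
  have h1 : `|1 - s| <= 5 / 4 by rewrite ler_norml; apply/andP; split; lra.
  have h2 : `|1 - s| + `|s| <= 3 / 2.
    have : `|1 - s| <= 5 / 4 by [].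
    have [s_ge0|s_lt0] := leP 0 s; have [s_le1|s_gt1] := leP s 1.
    - by rewrite (ger0_norm s_ge0) ger0_norm ?subr_ge0//; lra.
    - by rewrite (ger0_norm s_ge0) ltr0_norm ?subr_lt0//; lra.
    - by rewrite (ltr0_norm s_lt0) ger0_norm ?subr_ge0//; lra.
    - by lra.
  rewrite (le_trans (ler_normD _ _))// !normrZ.
  have : `|1 - s| * `|x - chart c c| <= `|1 - s| * (rho / 2) by rewrite ler_wpM2l.
  have : `|s| * `|y - chart c c| <= `|s| * (rho / 2) by rewrite ler_wpM2l.
  have : (`|1 - s| + `|s|) * (rho / 2) <= 3 / 2 * (rho / 2).
    by rewrite ler_wpM2r// divr_ge0// ltW.
  rewrite mulrDl; lra.
have [||||||||l' l'A path] := @chart_path _ _ _ c (fun s => x + s *: (y - x))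
    (fun=> y - x) 4^-1 (fun s => 0 + s *: A) (fun=> A).
- by rewrite invr_gt0.
- by move=> s /inball/B[].
- by move=> s _; exact: is_derive_line.
- by move=> s _; exact: cst_continuous.
- by move=> s _; exact: is_derive_line.
- by move=> s _; exact: cst_continuous.
- by [].
- move=> s /andP[s0 s1].
  have /inball/B[_ _ gK _ _] : - (4^-1) < s < 1 + 4^-1.
    by apply/andP; split; lra.
  apply: (le_trans (ler_norm _)); apply: (le_trans (form_bound _ _ _)).
  rewrite /A exprMn sqr_sqrtr; last by rewrite mulr_ge0 ?sqr_ge0// ltW.
  rewrite [leRHS](_ : _ = m%:R ^+ 2 * K * `|y - x| * `|y - x|); last by ring.
  by do 2 (apply: ler_wpM2r => //); rewrite ler_wpM2l// sqr_ge0.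
exists l'.
  by apply: (le_trans l'A); rewrite !add0r scale0r subr0 scale1r.
by move=> p l; have := path p l; rewrite scale0r addr0 scale1r subrKC.
Qed.

(** This orientation and that of [path_center] both occur: [rball pbar r] measures [rdist pbar q],
    while convergence measures [rdist (p k) pbar]. *)
Lemma center_path q : chart_dom c q -> `|chart c q - chart c c| <= rho / 2 ->
  exists2 l', l' <= Num.sqrt (m%:R ^+ 2 * K) * `|chart c q - chart c c| &
    forall p l, piecewise_C1 p c l -> piecewise_C1 p q (l + l').
Proof.
move=> cq qr; have cc := chart_dom_center c; have [rho0 _ _ _] := bnd.
have [|l' l'A path] := segment_path (x := chart c c) _ qr.
  by rewrite subrr normr0 divr_ge0// ltW.
by exists l' => // p l; have := path p l; rewrite !chartK.
Qed.

Lemma path_center q : chart_dom c q -> `|chart c q - chart c c| <= rho / 2 ->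
  exists2 l', l' <= Num.sqrt (m%:R ^+ 2 * K) * `|chart c q - chart c c| &
    forall p l, piecewise_C1 p q l -> piecewise_C1 p c (l + l').
Proof.
move=> cq qr; have cc := chart_dom_center c; have [rho0 _ _ _] := bnd.
have [|l' l'A path] := segment_path (y := chart c c) qr.
  by rewrite subrr normr0 divr_ge0// ltW.
exists l'; first by rewrite distrC.
by move=> p l; have := path p l; rewrite !chartK.
Qed.

(* Shifting the start of [y] by [w] along [y s + (1 - s) w] changes the energy
   by [- 2 <w, y' 0> + O(|w|^2)]: by Euler-Lagrange the first-order part of the
   energy density is the derivative of [2 (1 - s) <w, y' s>]. *)
Lemma first_variation (y : R -> M) (w : 'rV[R]_m) (D : R) :
  geodesic 0 1 y ->
  (forall s : R, 0 <= s <= 1 ->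
     chart_dom c (y s) /\ `|chart c (y s) - chart c c| <= rho / 4) ->
  tnorm (y 0) (velocity y 0) <= Num.sqrt lam ->
  `|w| <= rho / 4 -> `|w| <= 1 -> 0 < D ->
  tnorm (y 0) (velocity y 0) ^+ 2 + 8 * (m%:R ^+ 2 * K) * `|w| ^+ 2
    - 2 * form (gram c (chart c (y 0))) w (derive1 (chart c \o y) 0) <= D ^+ 2 ->
  rdist (chart_inv c (chart c (y 0) + w)) (y 1) <= D.
Proof.
move=> geo near_c slow wr w1 D0; have [rho0 _ K0 B] := bnd.
set x := chart c \o y; set x' := derive1 x.
set N := tnorm _ _; set C := m%:R ^+ 2 * K.
rewrite -[chart c (y 0)]/(x 0) => HD.
have C0 : 0 <= C by rewrite mulr_ge0// ?sqr_ge0// ltW.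
have x'1 (s : R) : 0 <= s <= 1 -> `|x' s| <= 1.
  move=> s01; have [ys yr] := near_c s s01.
  apply: (le_trans (geodesic_chart_velocity geo s01 ys _)).
    by apply: (le_trans yr); rewrite ler_pdivrMr// ler_peMr// ?ltW//; lra.
  by rewrite ler_pdivrMr ?sqrtr_gt0// mul1r.
have xN (s : R) : 0 <= s <= 1 -> form (gram c (x s)) (x' s) (x' s) = N ^+ 2.
  by move=> s01; have [ys _] := near_c s s01; exact: geodesic_chart_speed geo s01 ys.
have [e1 e1_gt0 geoJ] := geo.
set J := `]0 - e1, 1 + e1[%classic in geoJ.
have Jo : open J by exact: itv_open.
pose good (s : R) := chart_dom c (y s) /\ `|x s - chart c c| < rho / 2.
have good_nbhs (s : R) : 0 <= s <= 1 -> \forall u \near s, good u /\ J u.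
  move=> s01; have [ys yr] := near_c s s01.
  have Js : J s.
    rewrite /J/= in_itv/=; case/andP: s01 => s0 s1; apply/andP; split; lra.
  have [cont _] := geodesic_on_derivable geoJ Js.
  have H : \forall q \near y s, chart_dom c q /\ `|chart c q - chart c c| < rho / 2.
    by apply: chart_ball_nbhs => //; apply: (le_lt_trans yr); lra.
  near=> u; split; last by near: u; exact: open_nbhs_nbhs.
  by near: u; exact: (cont _ H).
(* Openness at both ends extends the bounds slightly beyond the unit interval. The cap [e <= 1]
   gives [|1 - s| <= 2] there, which keeps the perturbed curve [z] within
   [2 * (rho / 4) + rho / 2 = rho] of the center. *)
have [e e0 goodJ] : exists2 e, 0 < e <= 1 & forall s : R, - e < s < 1 + e -> good s /\ J s.
  have i0 : 0 <= (0 : R) <= 1 by rewrite lexx ler01.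
  have i1 : 0 <= (1 : R) <= 1 by rewrite lexx ler01.
  have /nbhs_ballP[ea /= ea0 Ha] := good_nbhs 0 i0.
  have /nbhs_ballP[eb /= eb0 Hb] := good_nbhs 1 i1.
  exists (Num.min 1 (Num.min ea eb)).
    by rewrite !lt_min ltr01 ea0 eb0 ge_min lexx.
  move=> s; rewrite ltrNl !lt_min -ltrBlDl !lt_min => /andP[/and3P[_ sa _] /and3P[_ _ sb]].
  have [s0|s0] := ltP s 0.
    by apply: Ha; rewrite /ball/= sub0r normrN ltr0_norm.
  have [s1|s1] := ltP 1 s.
    by apply: Hb; rewrite /ball/= distrC ger0_norm// subr_ge0 ltW.
  have s01 : 0 <= s <= 1 by rewrite s0 s1.
  exact: nbhs_singleton (good_nbhs s s01).
have dx (s : R) : - e < s < 1 + e -> is_derive s 1 x (x' s).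
  by move=> /goodJ[[ys _] Js]; exact: curve_derivableP (geodesic_on_derivable geoJ Js) ys.
have cx' (s : R) : - e < s < 1 + e -> {for s, continuous x'}.
  move=> /goodJ[[ys _] Js]; exact: is_derive1_continuous (geodesic_on_derive2 Jo geoJ Js ys).
have in01 (s : R) : 0 <= s <= 1 -> - e < s < 1 + e.
  by case/andP: e0 => ? ? /andP[? ?]; apply/andP; split; lra.
have img (s : R) : - e < s < 1 + e -> (chart c @` chart_dom c) (x s).
  by move=> /goodJ[[ys _] _]; exists (y s).
have Gsym s : - e < s < 1 + e -> (gram c (x s))^T = gram c (x s).
  by move=> /goodJ[[ys _] _]; exact: gram_sym.
pose h (s : R) := (1 - s) * form (gram c (x s)) w (x' s).
pose h' (s : R) := - form (gram c (x s)) w (x' s) +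
  (1 - s) * (2^-1 * form (dgram c (x s) w) (x' s) (x' s)).
have dh (s : R) : - e < s < 1 + e -> is_derive s 1 h (h' s).
  move=> /goodJ[[ys _] Js].
  have d1 : is_derive s 1 (fun u : R => 1 - u) (-1).
    have -> : (fun u : R => 1 - u) = (fun u => 1 + u *: (-1)).
      by apply/funext => u; rewrite /GRing.scale/=; lra.
    exact: is_derive_line.
  have D2 := is_deriveM d1 (euler_lagrange w Jo geoJ Js ys).
  refine (is_derive_eq D2 _).
  by rewrite /h' /GRing.scale/= addrC mulrN1.
have ch' (s : R) : - e < s < 1 + e -> {for s, continuous h'}.
  move=> sJ; have xs := is_derive1_continuous (dx s sJ).
  have cw : {for s, continuous (fun=> w : 'rV[R]_m)} by exact: cst_continuous.
  have cG : {for s, continuous (gram c \o x)}.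
    by apply: continuous_comp; [exact: xs|exact/gram_continuous/img].
  have cdG : {for s, continuous (fun u => dgram c (x u) w)}.
    apply: (@continuous_comp _ _ _ x (fun u => dgram c u w)); first exact: xs.
    exact/dgram_continuous/img.
  apply: cvgD; first exact: cvgN (continuous_form cG cw (cx' s sJ)).
  apply: cvgM; first by apply: cvgB; [exact: cvg_cst|exact: cvg_id].
  by apply: cvgM; [exact: cvg_cst|exact: (continuous_form cdG (cx' s sJ) (cx' s sJ))].
pose T := N ^+ 2 + 8 * C * `|w| ^+ 2.
pose z (s : R) := x s + (w + s *: (- w)).
have zE (s : R) : z s - x s = (1 - s) *: w.
  by rewrite /z addrC addKr scalerN scalerBl scale1r.
have zr (s : R) : - e < s < 1 + e -> `|z s - chart c c| <= rho.
  move=> sJ; have [[_ xr] _] := goodJ s sJ.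
  have -> : z s - chart c c = (z s - x s) + (x s - chart c c) by rewrite addrA subrK.
  rewrite zE (le_trans (ler_normD _ _))// normrZ.
  have : `|1 - s| * `|w| <= 2 * (rho / 4).
    apply: ler_pM => //; rewrite ler_norml.
    by case/andP: e0 => ? ?; case/andP: sJ => ? ?; apply/andP; split; lra.
  lra.
(* The target [D] serves as the weight in AM-GM: as [h 1 = 0], the increment of [psi] is
   [(T + D ^+ 2 - 2 * h 0) / (2 * D)], which is at most [D] exactly when [HD] holds. *)
pose psi (s : R) := (2 * D)^-1 *: ((0 + s *: (T + D ^+ 2)) + 2 *: h s).
pose dpsi (s : R) := (2 * D)^-1 *: ((T + D ^+ 2) + 2 *: h' s).
have speed (s : R) : 0 <= s <= 1 ->
    form (gram c (z s)) (x' s - w) (x' s - w) <= T + 2 * h' s.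
  move=> s01; have sJ := in01 s s01; have [[ys xr] _] := goodJ s sJ.
  have xrho : `|x s - chart c c| <= rho by rewrite ltW// (lt_le_trans xr)//; lra.
  have [_ _ gK dgK /(_ _ (zr s sJ))[_ tay]] := B _ xrho.
  have := @form_perturb (gram c (x s)) (gram c (z s)) (dgram c (x s) w) (x' s) w
    (1 - s) K (Gsym s sJ).
  rewrite zE (dgramZ (1 - s) w (img s sJ)) normrZ exprMn in tay.
  have s01' : 0 <= 1 - s <= 1 by case/andP: s01 => ? ?; apply/andP; split; lra.
  have tay' : `|gram c (z s) - gram c (x s) - (1 - s) *: dgram c (x s) w|
      <= K * `|w| ^+ 2.
    apply: (le_trans tay); rewrite ler_wpM2l ?(ltW K0)// ler_piMl ?sqr_ge0//.
    by rewrite real_normK ?num_real// expr_le1//; case/andP: s01'.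
  move=> /(_ s01' (ltW K0) (x'1 s s01) w1 gK (dgK w) tay').
  by rewrite (xN s s01) addrAC.
have speed0 (s : R) : 0 <= s <= 1 -> 0 <= T + 2 * h' s.
  move=> s01; apply: le_trans (speed s s01); have sJ := in01 s s01.
  have [_ coer _ _ _] := B _ (zr s sJ).
  by apply: le_trans (coer _); rewrite mulr_ge0 ?sqr_ge0// ltW.
have [||||||||l' l'psi path] := @chart_path _ _ _ c z (fun s => x' s - w) e psi dpsi.
- by case/andP: e0.
- by move=> s /zr/B[].
- by move=> s sJ; apply: is_deriveD; [exact: dx|exact: is_derive_line].
- by move=> s sJ; apply: cvgB; [exact: cx'|exact: cvg_cst].
- move=> s /in01 sJ; apply: is_deriveZ; apply: is_deriveD; first exact: is_derive_line.
  by apply: is_deriveZ; exact: dh.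
- move=> s /in01 sJ; apply: cvgM; first exact: cvg_cst.
  apply: cvgD; first exact: cvg_cst.
  by apply: cvgM; [exact: cvg_cst|exact: ch'].
- move=> s s01; rewrite /dpsi /GRing.scale/= mulr_ge0//.
    by rewrite invr_ge0 mulr_ge0// ltW.
  by have := speed0 s s01; have := sqr_ge0 D; lra.
- move=> s s01; apply: (le_trans (speed s s01)).
  rewrite /dpsi /GRing.scale/=; move: (h' s) => u.
  (* AM-GM: [sqrt u <= (u + D^2) / (2 D)] turns the energy bound into a length bound *)
  have -> : ((2 * D)^-1 * (T + D ^+ 2 + 2 * u)) ^+ 2 =
      (T + 2 * u) + ((2 * D)^-1 * (T + 2 * u - D ^+ 2)) ^+ 2.
    by field; rewrite gt_eqF.
  by rewrite lerDl sqr_ge0.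
have i1 : 0 <= (1 : R) <= 1 by rewrite lexx ler01.
have := path _ _ (piecewise_C1_refl (chart_inv c (z 0))).
have -> : z 0 = x 0 + w by rewrite /z scale0r addr0.
have -> : z 1 = x 1 by rewrite /z scale1r subrr addr0.
rewrite [chart_inv c (x 1)]chartK; last by have [] := near_c 1 i1.
move=> /rdist_le /le_trans; apply; rewrite add0r (le_trans l'psi)//.
have h1 : h 1 = 0 by rewrite /h subrr mul0r.
have h0 : h 0 = form (gram c (x 0)) w (x' 0) by rewrite /h subr0 mul1r.
move: HD h0; rewrite -/T; move: (form _ _ _) => f HD h0.
have -> : psi 1 - psi 0 = (2 * D)^-1 * (T + D ^+ 2 - 2 * f).
  by rewrite /psi h1 h0 /GRing.scale/=; ring.
rewrite ler_pdivrMl; last by rewrite mulr_gt0.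
have -> : 2 * D * D = D ^+ 2 + D ^+ 2 by ring.
by rewrite addrAC lerD2r.
Unshelve. all: by end_near. Qed.

End Bounds.
End LocalGeometry.

(** * The local law of cosines *)

Section Hinge.
Context {R : realType} {m : nat} {M : riemannian R m}.
Variables (c : M) (rho lam K : R).
Hypothesis bnd : chart_bounds c rho lam K.

Let lam0 : 0 < lam. Proof. by case: bnd. Qed.
Let K0 : 0 < K. Proof. by case: bnd. Qed.

(* Integrating [<u, gamma'>], whose derivative Euler-Lagrange bounds by
   [O(|gamma'|^2)], instead of expanding [gamma] itself avoids any bound on the
   second derivative of [gamma]. *)
Lemma geodesic_displacement (gamma : R -> M) (t V : R) (u : 'rV[R]_m) :
  0 <= t -> geodesic 0 t gamma ->
  V = tnorm (gamma 0) (velocity gamma 0) / Num.sqrt lam ->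
  (forall s : R, 0 <= s <= t -> [/\ chart_dom c (gamma s),
     `|chart c (gamma s) - chart c c| <= rho &
     `|chart c (gamma s) - chart c (gamma 0)| <= V * s]) ->
  `|u| <= 1 ->
  0 <= form (gram c (chart c (gamma 0))) u (derive1 (chart c \o gamma) 0) ->
  - (2 * (m%:R ^+ 2 * K) * (V * t) ^+ 2) <=
  form (gram c (chart c (gamma 0))) u (chart c (gamma t) - chart c (gamma 0)).
Proof.
move=> t0 geo VE stay u1 g0; have [_ _ _ B] := bnd.
have V0 : 0 <= V by rewrite VE divr_ge0 ?sqrtr_ge0.
set x := chart c \o gamma; set x' := derive1 x.
set C := m%:R ^+ 2 * K; have C0 : 0 <= C by rewrite mulr_ge0 ?sqr_ge0// ltW.
have [e e0 geoJ] := geo; set J := `]0 - e, t + e[%classic in geoJ.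
have Jo : open J by exact: itv_open.
have JE (s : R) : 0 <= s <= t -> J s.
  by rewrite /J/= in_itv/= => /andP[s0 st]; apply/andP; split; lra.
have x'V (s : R) : 0 <= s <= t -> `|x' s| <= V.
  by move=> s01; rewrite VE; have [cs sr _] := stay s s01;
     exact: (geodesic_chart_velocity bnd geo s01 cs sr).
have i0 : 0 <= (0 : R) <= t by rewrite lexx.
have [c0 r0 _] := stay 0 i0.
pose f (s : R) := form (gram c (x 0)) u (x s).
have df (s : R) : 0 <= s <= t -> is_derive s 1 f (form (gram c (x 0)) u (x' s)).
  move=> s01; have [cs _ _] := stay s s01.
  have dx := curve_derivableP (geodesic_on_derivable geoJ (JE s s01)) cs.
  have := is_derive_form (is_derive_cst (gram c (x 0)) s 1) (is_derive_cst u s 1) dx.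
  move=> D; refine (is_derive_eq D _).
  by rewrite /form mulmx0 !mul0mx !mxE !add0r.
have dg (s : R) : 0 <= s <= t ->
    `|form (gram c (x s)) u (x' s) - form (gram c (x 0)) u (x' 0)| <=
    2^-1 * C * V ^+ 2 * (s - 0).
  move=> /andP[s0 st].
  apply: (@derive_bound _ (fun s => form (gram c (x s)) u (x' s)) (fun s =>
    2^-1 * form (dgram c (x s) u) (x' s) (x' s))) => // r /andP[r0' rs];
    have rt : 0 <= r <= t by rewrite r0' (le_trans rs st).
    by have [cr _ _] := stay r rt; exact: (euler_lagrange u Jo geoJ (JE r rt) cr).
  have [cr rr _] := stay r rt; have [_ _ _ dgK _] := B _ rr.
  rewrite normrM ger0_norm ?invr_ge0//.
  rewrite -[2^-1 * C * _]mulrA ler_wpM2l ?invr_ge0//.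
  have uK : `|dgram c (x r) u| <= K.
    by apply: (le_trans (dgK u)); rewrite ler_piMr// ltW.
  apply: (le_trans (form_bound_le uK (x'V r rt) (x'V r rt))).
  by rewrite expr2 mulrA.
(* The change of momentum along the curve costs [2^-1 * C * V ^+ 2 * s] ([dg]), and freezing the
   metric at [x 0] costs [C * V ^+ 2 * s] ([h2]); the factor [2] covers both. *)
have lower (s : R) : 0 <= s <= t ->
    - (2 * C * V ^+ 2 * t) <= form (gram c (x 0)) u (x' s).
  move=> s01; have [cs sr ds] := stay s s01; have [_ _ _ _ /(_ _ sr)[lip _]] := B _ r0.
  have h1 := dg s s01.
  have h2 : `|form (gram c (x s)) u (x' s) - form (gram c (x 0)) u (x' s)| <=
      C * V ^+ 2 * s.
    rewrite -formBm; have -> : C * V ^+ 2 * s = m%:R ^+ 2 * (K * (V * s)) * 1 * V.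
      by rewrite /C; ring.
    apply: form_bound_le => //; last exact: x'V.
    by apply: (le_trans lip); rewrite ler_wpM2l// ltW.
  have CV0 : 0 <= C * V ^+ 2 by rewrite mulr_ge0// sqr_ge0.
  have [s0 st] := andP s01.
  have h3 : C * V ^+ 2 * s <= C * V ^+ 2 * t by rewrite ler_wpM2l.
  have h4 : 0 <= C * V ^+ 2 * s by rewrite mulr_ge0.
  move: h1 h2 g0; rewrite -[derive1 _ 0]/(x' 0) -[chart c (gamma 0)]/(x 0) subr0.
  move: (form (gram c (x s)) u (x' s)) (form (gram c (x 0)) u (x' s)) => g1 g2.
  move: (form (gram c (x 0)) u (x' 0)) => g3.
  have -> : 2^-1 * C * V ^+ 2 * s = 2^-1 * (C * V ^+ 2 * s) by ring.
  have -> : 2 * C * V ^+ 2 * t = 2 * (C * V ^+ 2 * t) by ring.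
  move: (C * V ^+ 2 * s) (C * V ^+ 2 * t) h3 h4 => q1 q2.
  clear; rewrite !ler_norml => ? ? /andP[? ?] /andP[? ?] ?; lra.
have [s|s|s s01 fE] := @MVT_segment _ f (fun s => form (gram c (x 0)) u (x' s)) 0 t t0.
- by rewrite in_itv/= => /andP[s0 st]; apply: df; rewrite !ltW.
- by move: s; apply: within_continuous_for => s/=; rewrite in_itv/= => /df/is_derive1_continuous.
- have -> : form (gram c (chart c (gamma 0))) u (chart c (gamma t) - chart c (gamma 0)) =
      f t - f 0 by rewrite /f formBr.
  rewrite fE subr0; have -> : - (2 * C * (V * t) ^+ 2) = - (2 * C * V ^+ 2 * t) * t.
    by ring.
  rewrite in_itv/= in s01.
  exact: (ler_wpM2r t0 (lower s s01)).
Qed.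

(* A local law of cosines, valid without curvature assumptions: if the angle at
   [y 0] between the geodesics [y] (towards [c]) and [gamma] is at most a right
   angle, moving along [gamma] increases the squared distance to [c] by at most a
   multiple of the squared length of the move. *)
Lemma hinge : exists r C : R, [/\ 0 < r, 0 <= C &
  forall (y gamma : R -> M) (t : R),
    chart_dom c (y 0) -> `|chart c (y 0) - chart c c| <= r ->
    geodesic 0 1 y -> y 1 = c -> tnorm (y 0) (velocity y 0) <= r ->
    0 <= t -> geodesic 0 t gamma -> gamma 0 = y 0 ->
    t * tnorm (gamma 0) (velocity gamma 0) <= r ->
    0 <= inner (y 0) (velocity y 0) (derive1 (chart (y 0) \o gamma) 0) ->
    [/\ chart_dom c (gamma t),
        `|chart c (gamma t) - chart c (y 0)| <=
          t * tnorm (gamma 0) (velocity gamma 0) / Num.sqrt lam &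
        rdist (gamma t) c ^+ 2 <= tnorm (y 0) (velocity y 0) ^+ 2 +
          C * (t * tnorm (gamma 0) (velocity gamma 0)) ^+ 2]].
Proof.
have [rho0 _ _ B] := bnd.
have sl0 : 0 < Num.sqrt lam by rewrite sqrtr_gt0.
pose C := m%:R ^+ 2 * K; have C0 : 0 <= C by rewrite mulr_ge0 ?sqr_ge0// ltW.
(* The second bound makes metric lengths up to [r] into coordinate lengths up to [rho / 4] and [1],
   the smallness assumed by [first_variation]. *)
pose r := Num.min (rho / 4) (Num.sqrt lam * Num.min (rho / 4) 1).
have r0 : 0 < r by rewrite !lt_min divr_gt0//= mulr_gt0// lt_min divr_gt0//=.
have rV (a : R) : a <= r -> a / Num.sqrt lam <= rho / 4 /\ a / Num.sqrt lam <= 1.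
  rewrite /r le_min => /andP[_]; rewrite mulrC -ler_pdivrMr// le_min => /andP[]//.
(* [12] is [8] from [first_variation] plus twice the [2] of [geodesic_displacement]; [1 / lam]
   converts squared coordinate length into squared metric length. *)
exists r, (12 * C / lam); split => //; first by rewrite divr_ge0 ?mulr_ge0// ltW.
move=> y gamma t cq qr ygeo y1 yr t0 ggeo g0 gr perp.
set N := tnorm (y 0) _ in yr *; set S := t * _ in gr *.
have [NV4 NV1] := rV _ yr; have [SV4 SV1] := rV _ gr.
have qr4 : `|chart c (y 0) - chart c c| <= rho / 4.
  by apply: (le_trans qr); rewrite ge_min lexx.
pose V := tnorm (gamma 0) (velocity gamma 0) / Num.sqrt lam.
have V0 : 0 <= V by rewrite divr_ge0 ?sqrtr_ge0.
have VtE : V * t = S / Num.sqrt lam by rewrite /V /S mulrC mulrA.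
have i0 : 0 <= (0 : R) <= 1 by rewrite lexx ler01.
have t00 : 0 <= (0 : R) <= t by rewrite lexx.
have tt0 : 0 <= t <= t by rewrite lexx t0.
have ystay (s : R) : 0 <= s <= 1 ->
    chart_dom c (y s) /\ `|chart c (y s) - chart c c| <= rho / 4.
  move=> s01; have := geodesic_stays_rev bnd ler01 ygeo.
  rewrite /= y1 subrr normr0 add0r subr0 mulr1 -/N.
  move=> /(_ (chart_dom_center c)); case/(_ _ s s01).
    by apply: (le_lt_trans NV4); lra.
  move=> cs /le_trans h; split => //; apply: h.
  have [s0 s1] := andP s01; apply: le_trans NV4; apply: ler_piMr.
    exact: divr_ge0 (sqrtr_ge0 _) (sqrtr_ge0 _).
  by rewrite lerBlDr lerDl.
have gstay (s : R) : 0 <= s <= t -> [/\ chart_dom c (gamma s),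
    `|chart c (gamma s) - chart c c| <= rho &
    `|chart c (gamma s) - chart c (gamma 0)| <= V * s].
  move=> st; have := geodesic_stays bnd t0 ggeo; rewrite /= -/V g0 !subr0 VtE.
  move=> /(_ cq); case/(_ _ s st).
    by have := qr4; have := SV4; lra.
  rewrite subr0 => cs h; split => //.
  have := ler_distD (chart c (y 0)) (chart c (gamma s)) (chart c c).
  have : V * s <= V * t by apply: ler_wpM2l => //; case/andP: st.
  by have := qr4; have := SV4; rewrite VtE; lra.
have [cgt _ gtr] := gstay t tt0.
rewrite g0 VtE in gtr.
pose u := derive1 (chart c \o y) 0; pose w := chart c (gamma t) - chart c (y 0).
have yd := geodesic_derivable ygeo i0; have gd := geodesic_derivable ggeo t00.
have u1 : `|u| <= 1.
  apply: (le_trans (geodesic_chart_velocity bnd ygeo i0 cq _)) => //.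
  by apply: (le_trans qr4); lra.
have cg0 : chart_dom c (gamma 0) by rewrite g0.
have gq0 : chart_dom (y 0) (gamma 0) by rewrite g0; exact: chart_dom_center.
have perp' : 0 <= form (gram c (chart c (gamma 0))) u (derive1 (chart c \o gamma) 0).
  have d1 := curve_derivableP yd cq; have d2 := curve_derivableP gd cg0.
  have d3 := curve_derivableP yd (chart_dom_center (y 0)).
  have d4 := curve_derivableP gd gq0.
  have E := form_chart cq (chart_dom_center (y 0)) erefl g0 yd.1 gd.1 d1 d2 d3 d4.
  by rewrite g0 /u E.
have := geodesic_displacement (V := V) t0 ggeo erefl gstay u1 perp'.
rewrite g0 -/w VtE => disp.
have wS : `|w| ^+ 2 <= S ^+ 2 / lam.
  have -> : S ^+ 2 / lam = (S / Num.sqrt lam) ^+ 2.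
    by rewrite expr_div_n sqr_sqrtr// ltW.
  by rewrite ler_sqr ?nnegrE// (le_trans _ gtr).
split => //.
have T0 : 0 <= N ^+ 2 + 12 * C / lam * S ^+ 2.
  by rewrite addr_ge0 ?sqr_ge0// mulr_ge0 ?sqr_ge0// divr_ge0 ?mulr_ge0// ltW.
suff le : rdist (gamma t) c <= Num.sqrt (N ^+ 2 + 12 * C / lam * S ^+ 2).
  by rewrite -(sqr_sqrtr T0) ler_sqr ?nnegrE ?rdist_ge0 ?sqrtr_ge0.
(* [first_variation] asks for a positive bound [D], and the square root may vanish. *)
apply/ler_addgt0Pr => e e0.
set D := Num.sqrt _ + e; have D0 : 0 < D by rewrite ltr_wpDl ?sqrtr_ge0.
have -> : gamma t = chart_inv c (chart c (y 0) + w).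
  by rewrite /w subrKC chartK.
rewrite -[X in rdist _ X]y1; apply: (first_variation bnd ygeo ystay) => //.
- by rewrite -(mul1r (Num.sqrt _)) -ler_pdivrMr.
- exact: le_trans gtr SV4.
- exact: le_trans gtr SV1.
have TD : N ^+ 2 + 12 * C / lam * S ^+ 2 <= D ^+ 2.
  rewrite -[leLHS]sqr_sqrtr// ler_sqr ?nnegrE ?sqrtr_ge0 ?(ltW D0)//.
  by rewrite /D lerDl ltW.
apply: le_trans TD; rewrite -addrA lerD2l.
rewrite (form_sym w _ (gram_sym cq)) -/u.
have SlamE : (S / Num.sqrt lam) ^+ 2 = S ^+ 2 / lam.
  by rewrite expr_div_n sqr_sqrtr// ltW.
rewrite SlamE in disp.
have -> : 12 * C / lam * S ^+ 2 = 8 * C * (S ^+ 2 / lam) + 2 * (2 * C * (S ^+ 2 / lam)).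
  by field; rewrite gt_eqF.
apply: lerD; first by apply: (ler_wpM2l _ wS); exact: mulr_ge0.
by rewrite -mulrN; apply: ler_wpM2l => //; rewrite lerNl.
Qed.

End Hinge.

(** * The descent algorithm *)

Section Descent.
Context {R : realType} {m n : nat} {M : riemannian R m}.
Implicit Types (F : M -> 'rV[R]_n.+1) (p q : M).

Lemma inner_ge0 p (u : tangent p) : 0 <= inner p u u.
Proof. exact: (posdef_ge0 _ (gram_posdef (chart_dom_center p))). Qed.

Lemma tnorm_sqr p (u : tangent p) : tnorm p u ^+ 2 = inner p u u.
Proof. by rewrite sqr_sqrtr// inner_ge0. Qed.

Lemma JF_le_alpha F p (v : tangent p) i :
  JF F p v 0 i <= alpha F p v - 2^-1 * tnorm p v ^+ 2.
Proof.
rewrite mxE /alpha addrK.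
exact: (le_bigmax _ (fun i => inner p (grad (objective F i) p) v) i).
Qed.

Lemma alpha_scale_le F p (v : 'rV[R]_m) (s : R) : 0 <= s ->
  alpha F p (s *: v : 'rV[R]_m) <=
  s * (alpha F p v - 2^-1 * tnorm p v ^+ 2) + s ^+ 2 * (2^-1 * tnorm p v ^+ 2).
Proof.
move=> s0; rewrite /alpha.
have -> : tnorm p (s *: v : 'rV[R]_m) ^+ 2 = s ^+ 2 * tnorm p v ^+ 2.
  rewrite !tnorm_sqr -[inner _ _ _]/(form _ _ _) formZl formZr.
  by rewrite mulrA expr2.
rewrite addrK [2^-1 * (s ^+ 2 * _)]mulrCA lerD2r.
have term i : inner p (grad (objective F i) p) (s *: v : 'rV[R]_m) <=
    s * \big[Num.max/inner p (grad (objective F ord0) p) v]_(i < n.+1)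
      inner p (grad (objective F i) p) v.
  rewrite -[inner _ _ _]/(form _ _ _) formZr ler_wpM2l//.
  exact: (le_bigmax _ (fun i => inner p (grad (objective F i) p) v) i).
by apply: bigmax_le => // i _.
Qed.

(* Scaling a minimizer [v] of [alpha] shows [max <grad f_i, v> = - |v|^2]. If
   there were no minimizer, [steepest_descent] would be its default value [0]. *)
Lemma alpha_star_le F p :
  alpha_star F p <= - (2^-1 * tnorm p (steepest_descent F p) ^+ 2).
Proof.
rewrite /alpha_star /steepest_descent; case: xgetP => [v _ /= vmin|_].
  have N0 : 0 <= 2^-1 * tnorm p v ^+ 2 by rewrite mulr_ge0 ?invr_ge0 ?sqr_ge0.
  have scale (s : R) : 0 <= s -> alpha F p v <=
      s * (alpha F p v - 2^-1 * tnorm p v ^+ 2) + s ^+ 2 * (2^-1 * tnorm p v ^+ 2).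
    by move=> s0; apply: le_trans (vmin _) (alpha_scale_le F p v s0).
  move: (alpha F p v) (2^-1 * tnorm p v ^+ 2) N0 scale => a N N0 scale.
  clear vmin; rewrite leNgt; apply/negP => aN.
  (* Minimality is contradicted at [(1 - e) *: v] as soon as [0 < e <= 1] and [e * N < a + N]; this
     [e] satisfies both, also when [N = 0]. *)
  pose e := (a + N) / (a + N + N).
  have aN0 : 0 < a + N by lra.
  have d0 : 0 < a + N + N by lra.
  have e0 : 0 < e by rewrite divr_gt0.
  have e1 : e <= 1 by rewrite ler_pdivrMr// mul1r lerDl.
  have eN : e * (a + N + N) = a + N by rewrite divfK// gt_eqF.
  have := scale (1 - e); rewrite subr_ge0 => /(_ e1).
  have -> : (1 - e) * (a - N) + (1 - e) ^+ 2 * N = a - e * (a + N - e * N) by ring.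
  rewrite lerBrDr gerDl pmulr_rle0// -eN.
  have : 0 < e * (a + N) by rewrite mulr_gt0.
  lra.
have := alpha_scale_le F p (0 : 'rV[R]_m) (lexx 0).
rewrite scaler0 mul0r expr0n mul0r addr0 => /le_trans; apply.
rewrite tnorm_sqr -[inner _ _ _]/(form _ _ _) form0l mulr0 oppr0//.
Qed.

(** The two squared norms have distinct uses: that of [v] bounds the step lengths by the decrease of
    [F], that of the steepest descent direction meets the growth condition of (ii). *)
Lemma descent_set_JF F (sigma : R) p (v : tangent p) i : sigma < 1 ->
  descent_set F sigma p v ->
  JF F p v 0 i <= - ((1 - sigma) / 2 * tnorm p (steepest_descent F p) ^+ 2
                     + 2^-1 * tnorm p v ^+ 2).
Proof.
move=> s1 vD; apply: (le_trans (JF_le_alpha F v i)).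
have h : (1 - sigma) * alpha_star F p <=
    (1 - sigma) * - (2^-1 * tnorm p (steepest_descent F p) ^+ 2).
  by rewrite ler_wpM2l ?alpha_star_le// subr_ge0 ltW.
rewrite opprD lerD2r (le_trans vD)// (le_trans h)//.
by rewrite mulrN lerN2 -mulrA.
Qed.

Lemma C1_map_continuous F p i : C1_map F -> {for p, continuous (fun q => F q 0 i)}.
Proof.
move=> F1; have pp := chart_dom_center p.
have [dF _] := F1 p; have {}dF := dF (chart p p) (ex_intro2 _ _ p pp erefl).
have cF : {for p, continuous (fun q => F (chart_inv p (chart p q)) 0 i)}.
  apply: (@continuous_comp _ _ _ (fun q => F (chart_inv p (chart p q)))
    (fun x : 'rV[R]_n.+1 => x 0 i)); last exact: coord_continuous.
  apply: (@continuous_comp _ _ _ (chart p) (F \o chart_inv p)).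
    exact: chart_continuous.
  exact: differentiable_continuous.
rewrite /prop_for/continuous_at -[F p 0 i]/((fun q => F q 0 i) p) -{2}(chartK pp).
apply: cvg_trans cF; apply: near_eq_cvg.
by apply: filterS (chart_dom_nbhs pp) => q pq; rewrite chartK.
Qed.

Lemma is_derive_objective F i (gamma : R -> M) (t : R) : C1_map F ->
  curve_derivable gamma t ->
  is_derive t 1 (fun s => F (gamma s) 0 i)
    (inner (gamma t) (grad (objective F i) (gamma t)) (velocity gamma t)).
Proof.
move=> F1 gd; set p := gamma t; have pp := chart_dom_center p.
have [dF _] := F1 p; have {}dF := dF (chart p p) (ex_intro2 _ _ p pp erefl).
pose f : 'rV[R]_m -> R^o := objective F i \o chart_inv p.
have df : differentiable f (chart p p).
  apply: (@differentiable_comp _ _ _ _ (F \o chart_inv p) (fun x : 'rV_n.+1 => x 0 i : R^o)) => //.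
  exact: differentiable_coord.
have gp := curve_derivableP gd pp.
have D := is_derive_comp_diff (df : differentiable f ((chart p \o gamma) t)) gp.
apply: near_eq_is_derive (_ : is_derive t 1 (f \o (chart p \o gamma)) _).
  have [cg _] := gd; have := curve_chart_dom_nbhs cg pp.
  by apply: filterS => s ps; rewrite /f/= chartK.
refine (is_derive_eq D _).
rewrite derive_basis// /inner /grad mulmxKV; last exact/posdef_unitmx/gram_posdef.
by rewrite mxE; apply: eq_bigr => j _; rewrite !mxE mulrC.
Qed.

Lemma derive_le0_max (g : R -> R) (d : R) : is_derive (0 : R) 1 g d ->
  (forall s, 0 <= s <= 1 -> g s <= g 0) -> d <= 0.
Proof.
move=> [dg <-] gmax; rewrite leNgt; apply/negP => d0.
have /cvgrPdist_lt/(_ _ d0) : h^-1 *: (g (h *: 1 + 0) - g 0) @[h --> 0^'] --> 'D_1 g 0.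
  exact: dg.
move=> /nbhs_ballP[e /= e0 ball_e].
pose s := Num.min (e / 2) 1.
have s0 : 0 < s by rewrite lt_min divr_gt0/=.
have s1 : s <= 1 by rewrite ge_min lexx orbT.
have se : s < e.
  apply: (@le_lt_trans _ _ (e / 2)); first by rewrite ge_min lexx.
  by rewrite ltr_pdivrMr// ltr_pMr// ltr1n.
have := ball_e s; rewrite /ball/= sub0r normrN gtr0_norm// => /(_ se).
move=> /(_ (lt0r_neq0 s0)); rewrite addr0 [s *: 1]mulr1.
have : s^-1 *: (g s - g 0) <= 0.
  rewrite /GRing.scale/= mulr_ge0_le0 ?invr_ge0 ?subr_le0 ?(ltW s0)//.
  by apply: gmax; rewrite s1 ltW.
move=> le0; rewrite ltr_norml => /andP[_]; rewrite ltrBlDr -ltrBlDl subrr.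
by rewrite ltNge le0.
Qed.

End Descent.

(** * Monotonicity and step lengths along a run *)

Section Run.
Context {R : realType} {m n : nat} {M : riemannian R m}.
Variables (F : M -> 'rV[R]_n.+1) (sigma beta Rmax : R).
Variables (p : nat -> M) (v : forall k, tangent (p k)) (t : nat -> R) (pbar : M).
Hypotheses (hF : C1_map F) (hsigma : 0 < sigma < 1) (hbeta : 0 < beta < 1).
Hypothesis hRmax : 1 <= Rmax.
Hypothesis hrun : inexact_descent F sigma beta Rmax p v t.
Hypothesis hcluster : cluster (p @ \oo) pbar.

Definition run_step k : R := t k * tnorm (p k) (v k).

Lemma run_t_gt0 k : 0 < t k.
Proof. by have [_ _ /andP[]] := hrun k. Qed.

Lemma run_step_ge0 k : 0 <= run_step k.
Proof. by rewrite mulr_ge0 ?sqrtr_ge0// ltW// run_t_gt0. Qed.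

Lemma run_decrease k i : F (p k.+1) 0 i <= F (p k) 0 i - beta * t k *
  ((1 - sigma) / 2 * tnorm (p k) (steepest_descent F (p k)) ^+ 2
   + 2^-1 * tnorm (p k) (v k) ^+ 2).
Proof.
have [_ vD /andP[tk0 _] [gamma [_ _ _ /(_ i) dec ->]]] := hrun k.
have [beta0 _] := andP hbeta; have [_ sigma1] := andP hsigma.
apply: (le_trans dec); rewrite [leLHS]mxE lerD2l [leLHS]mxE -mulrN.
by apply: ler_wpM2l (descent_set_JF i sigma1 vD); rewrite mulr_ge0// ltW.
Qed.

(** One factor [t k] of the squared step is bounded by [Rmax]; the other comes from the Armijo
    decrease, at least [beta * t k] times half the squared norm of [v k]. *)
Lemma run_gain_step k i :
  run_step k ^+ 2 <= 2 * Rmax / beta * (F (p k) 0 i - F (p k.+1) 0 i).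
Proof.
have [_ _ /andP[tk0 tkR] _] := hrun k.
have [beta0 _] := andP hbeta; have [_ sigma1] := andP hsigma.
have := run_decrease k i; rewrite /run_step exprMn.
set N := tnorm _ (steepest_descent _ _) ^+ 2; set V := tnorm _ _ ^+ 2.
move=> dec.
have N0 : 0 <= (1 - sigma) / 2 * N.
  by rewrite mulr_ge0 ?sqr_ge0// divr_ge0// subr_ge0 ltW.
have V0 : 0 <= V by rewrite sqr_ge0.
have h1 : beta * t k * (2^-1 * V) <= F (p k) 0 i - F (p k.+1) 0 i.
  rewrite lerBrDl -lerBrDr (le_trans dec)// lerD2l lerN2.
  by apply: ler_wpM2l; [rewrite mulr_ge0// ltW|rewrite lerDr].
have h2 : t k ^+ 2 * V <= 2 * Rmax / beta * (beta * t k * (2^-1 * V)).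
  have -> : 2 * Rmax / beta * (beta * t k * (2^-1 * V)) = Rmax * (t k * V).
    by field; rewrite gt_eqF.
  by rewrite expr2 -mulrA; apply: ler_wpM2r => //; rewrite mulr_ge0// ltW.
apply: (le_trans h2); apply: ler_wpM2l => //.
by rewrite divr_ge0// ?mulr_ge0// ltW// (lt_le_trans ltr01).
Qed.

Lemma run_mono1 k i : F (p k.+1) 0 i <= F (p k) 0 i.
Proof.
have [_ _ /andP[tk0 _] _] := hrun k.
have [beta0 _] := andP hbeta; have [_ sigma1] := andP hsigma.
apply: (le_trans (run_decrease k i)); rewrite gerBl.
apply: mulr_ge0; first by rewrite mulr_ge0// ltW.
apply: addr_ge0; apply: mulr_ge0 (sqr_ge0 _); last by rewrite invr_ge0.
by rewrite divr_ge0// subr_ge0 ltW.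
Qed.

Lemma run_mono k l i : (k <= l)%N -> F (p l) 0 i <= F (p k) 0 i.
Proof.
move=> /subnK <-; elim: (l - k)%N => // j IH.
by apply: le_trans IH; rewrite addSn; exact: run_mono1.
Qed.

Lemma run_frequently (U : set M) K : (\forall q \near pbar, U q) ->
  exists2 k, (K <= k)%N & U (p k).
Proof.
move=> Unbhs.
have [q [[k /= Kk <-] Uq]] : (p @` [set k | (K <= k)%N]) `&` U !=set0.
  apply: hcluster => //; exists K => // k /= Kk; by exists k.
by exists k.
Qed.

(** Each objective is nonincreasing along the run, and by continuity it takes values arbitrarily
    close to that at the cluster point at arbitrarily late indices. *)
Lemma run_limit_le k i : F pbar 0 i <= F (p k) 0 i.
Proof.
rewrite leNgt; apply/negP => lt.
have /cvgrPdist_lt := @C1_map_continuous _ _ _ _ _ pbar i hF.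
move=> /(_ (F pbar 0 i - F (p k) 0 i)); rewrite subr_gt0 => /(_ lt).
move=> /(run_frequently k)[l kl]; apply/negP; rewrite -leNgt.
rewrite ger0_norm; first by rewrite lerD2l lerN2 run_mono.
by rewrite subr_ge0 (le_trans (run_mono i kl))// ltW.
Qed.

Lemma run_close (U : set M) i (e : R) : (\forall q \near pbar, U q) -> 0 < e ->
  forall K, exists k, [/\ (K <= k)%N, U (p k) & F (p k) 0 i - F pbar 0 i <= e].
Proof.
move=> Unbhs e0 K.
have /cvgrPdist_lt/(_ _ e0) Fnbhs := @C1_map_continuous _ _ _ _ _ pbar i hF.
have [k Kk [Uk Fk]] := run_frequently K (filterI Unbhs Fnbhs).
exists k; split => //; rewrite -opprB lerNl.
by move: Fk; rewrite /= ltr_norml => /andP[/ltW].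
Qed.

Lemma run_geodesic k : exists gamma : R -> M,
  [/\ geodesic 0 (t k) gamma, gamma 0 = p k,
      derive1 (chart (p k) \o gamma) 0 = v k,
      p k.+1 = gamma (t k) &
      t k * tnorm (gamma 0) (velocity gamma 0) = run_step k].
Proof.
have [_ _ _ [gamma [geo g0 gv _ pE]]] := hrun k.
exists gamma; split => //; rewrite /run_step; congr (_ * _).
have -> : tnorm (gamma 0) (velocity gamma 0) =
    tnorm (p k) (derive1 (chart (p k) \o gamma) 0) by rewrite /velocity g0.
by rewrite gv.
Qed.

Lemma run_path k q l : piecewise_C1 q (p k) l ->
  piecewise_C1 q (p k.+1) (l + run_step k).
Proof.
have [gamma [geo g0 _ -> <-]] := run_geodesic k; rewrite -g0.
by apply: geodesic_path => //; rewrite ltW// run_t_gt0.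
Qed.

(** The shift of index is paid by dividing [C] by [theta ^+ K], and the sum [S] dominates the first
    [K] ratios. *)
Lemma converges_linearly_eventually K (C theta : R) : 0 <= C -> 0 < theta < 1 ->
  (forall j, rdist (p (K + j)) pbar <= C * theta ^+ j) ->
  converges_linearly p pbar.
Proof.
move=> C0 th01 H; have [th0 th1] := andP th01.
pose S := \sum_(i < K) rdist (p i) pbar / theta ^+ i.
have S0 : 0 <= S.
  by apply: sumr_ge0 => i _; rewrite divr_ge0 ?rdist_ge0// exprn_ge0// ltW.
have CK0 : 0 <= C / theta ^+ K by rewrite divr_ge0// exprn_ge0// ltW.
exists (1 + (C / theta ^+ K + S)), theta; split => //.
  by rewrite ltr_pwDl// addr_ge0.
move=> k; have thk : 0 < theta ^+ k by rewrite exprn_gt0.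
have [Kk|kK] := leqP K k.
  have := H (k - K)%N; rewrite subnKC// => /le_trans; apply.
  have -> : C * theta ^+ (k - K) = C / theta ^+ K * theta ^+ k.
    rewrite -[in RHS](subnKC Kk) exprD mulrA divfK//.
    by rewrite gt_eqF// exprn_gt0.
  by apply: ler_wpM2r; [exact: ltW|rewrite addrCA lerDl addr_ge0].
rewrite -ler_pdivrMr//.
apply: (@le_trans _ _ S); last by rewrite addrA lerDr addr_ge0.
apply: (@ler_sum_term _ _ (fun i : 'I_K => rdist (p i) pbar / theta ^+ i) (Ordinal kK)).
by move=> j; rewrite divr_ge0 ?rdist_ge0// exprn_ge0// ltW.
Qed.

End Run.

(** * Assertion (ii): linear convergence *)

Section LinearConvergence.
Context {R : realType} {m n : nat} {M : riemannian R m}.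
Variables (F : M -> 'rV[R]_n.+1) (sigma beta Rmax : R).
Variables (p : nat -> M) (v : forall k, tangent (p k)) (t : nat -> R) (pbar : M).
Hypotheses (hF : C1_map F) (hsigma : 0 < sigma < 1) (hbeta : 0 < beta < 1).
Hypothesis hRmax : 1 <= Rmax.
Hypothesis hrun : inexact_descent F sigma beta Rmax p v t.
Hypothesis hcluster : cluster (p @ \oo) pbar.

Let run_ge k i := run_limit_le hF hsigma hbeta hrun hcluster k i.
Let close := run_close hF hcluster.

(* The competitor [pbar] in the supremum defining [phi] at [p k]. *)
Definition gap k : R :=
  \big[Num.min/objective F ord0 (p k) - objective F ord0 pbar]_(i < n.+1)
     (objective F i (p k) - objective F i pbar).

Lemma gap_le k i : gap k <= F (p k) 0 i - F pbar 0 i.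
Proof. exact: (bigmin_le _ i (fun i => objective F i (p k) - objective F i pbar)). Qed.

Lemma le_gap k (x : R) : (forall i, x <= F (p k) 0 i - F pbar 0 i) -> x <= gap k.
Proof. by move=> h; apply: le_bigmin => [|i _]; exact: h. Qed.

Lemma gap_ge0 k : 0 <= gap k.
Proof. by apply: le_gap => i; rewrite subr_ge0; exact: run_ge. Qed.

(** The guaranteed decrease is the same for all objectives, so their minimum inherits it. *)
Lemma gap_decrease k (tau : R) : 0 < tau <= t k ->
  gap k.+1 <= gap k - beta * tau *
    ((1 - sigma) / 2 * tnorm (p k) (steepest_descent F (p k)) ^+ 2).
Proof.
move=> /andP[tau0 tauk]; have [beta0 _] := andP hbeta; have [_ sigma1] := andP hsigma.
rewrite lerBrDr; apply: le_gap => i.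
have := gap_le k.+1 i; have := run_decrease hsigma hbeta hrun k i.
set N := tnorm _ (steepest_descent _ _) ^+ 2; set V := tnorm _ _ ^+ 2.
have N0 : 0 <= (1 - sigma) / 2 * N.
  by rewrite mulr_ge0 ?sqr_ge0// divr_ge0// subr_ge0 ltW.
have V0 : 0 <= 2^-1 * V by rewrite mulr_ge0 ?invr_ge0 ?sqr_ge0.
have : beta * tau * ((1 - sigma) / 2 * N) <= beta * t k * ((1 - sigma) / 2 * N + 2^-1 * V).
  apply: ler_pM => //; first by rewrite mulr_ge0// ltW.
    by apply: ler_wpM2l => //; exact: ltW.
  by rewrite lerDl.
move: (beta * tau * _) (beta * t k * _) => a b; lra.
Qed.

Lemma run_step_gap k : run_step v t k <= Num.sqrt (2 * Rmax / beta) * Num.sqrt (gap k).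
Proof.
have [beta0 _] := andP hbeta.
have B0 : 0 < 2 * Rmax / beta.
  by rewrite divr_gt0// mulr_gt0// (lt_le_trans ltr01).
rewrite -sqrtrM; last exact: ltW.
rewrite -[leLHS]ger0_norm ?(run_step_ge0 hrun)// -sqrtr_sqr.
apply: ler_wsqrtr; rewrite -ler_pdivrMl//; apply: le_gap => i.
rewrite ler_pdivrMl//.
apply: (le_trans (run_gain_step hsigma hbeta hRmax hrun k i)).
by apply: ler_wpM2l; [exact: ltW|rewrite lerD2l lerN2; exact: run_ge].
Qed.

Lemma linear_convergence : 0 < inf (range t) ->
  (exists a r : R, [/\ 0 < a, 0 < r & forall q, rball pbar r q ->
     (a%:E * phi F q <= (tnorm q (steepest_descent F q) ^+ 2)%:E)%E]) ->
  converges_linearly p pbar.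
Proof.
set tau := inf _ => tau0 [a [r [a0 r0 growth]]].
have [beta0 _] := andP hbeta; have [_ sigma1] := andP hsigma.
have tauk k : 0 < tau <= t k.
  rewrite tau0/=; apply: ge_inf; last by exists k.
  by exists 0 => _ [j _ <-]; exact/ltW/(run_t_gt0 hrun).
(* The maximum with [2^-1] keeps the ratio positive whatever the size of [a]. The rate [theta] is a
   square root because step lengths are of the order of the square root of the gap. *)
pose q2 := Num.max (1 - beta * tau * ((1 - sigma) / 2 * a)) 2^-1.
pose theta := Num.sqrt q2.
have q20 : 0 < q2 by rewrite lt_max invr_gt0 ltr0n orbT.
have q21 : q2 < 1.
  rewrite gt_max; apply/andP; split.
    by rewrite ltrBlDr ltrDl !mulr_gt0 ?subr_gt0 ?invr_gt0.
  by rewrite invf_lt1// ltr1n.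
have th0 : 0 < theta by rewrite sqrtr_gt0.
have th1 : theta < 1 by rewrite -sqrtr1 ltr_sqrt.
have contract k : rball pbar r (p k) ->
    Num.sqrt (gap k.+1) <= theta * Num.sqrt (gap k).
  move=> /growth; set N := tnorm _ _ ^+ 2 => gr.
  have gapN : a * gap k <= N.
    rewrite -lee_fin EFinM; apply: le_trans gr.
    apply: lee_wpmul2l; first by rewrite lee_fin ltW.
    by apply: ereal_sup_ubound; exists pbar.
  rewrite /theta -sqrtrM; last exact: ltW.
  apply: ler_wsqrtr.
  apply: (le_trans (gap_decrease (tauk k))); rewrite -/N.
  apply: (@le_trans _ _ ((1 - beta * tau * ((1 - sigma) / 2 * a)) * gap k)).
    have -> : (1 - beta * tau * ((1 - sigma) / 2 * a)) * gap k =
        gap k - beta * tau * ((1 - sigma) / 2 * (a * gap k)) by ring.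
    rewrite lerD2l lerN2; apply: ler_wpM2l; first by rewrite mulr_ge0// ltW.
    by apply: ler_wpM2l => //; rewrite divr_ge0// subr_ge0 ltW.
  by apply: ler_wpM2r; [exact: gap_ge0|rewrite le_max lexx].
have [rho [lam [K bnd]]] := chart_bounds_exist pbar.
have [rho0 lam0 K0 _] := bnd.
set A := Num.sqrt (m%:R ^+ 2 * K).
have A0 : 0 <= A by rewrite sqrtr_ge0.
pose B := Num.sqrt (2 * Rmax / beta); have B0 : 0 <= B by rewrite sqrtr_ge0.
have near_nbhs (e : R) : 0 < e -> \forall q \near pbar,
    chart_dom pbar q /\ `|chart pbar q - chart pbar pbar| < Num.min (rho / 2) (e / (A + 1)).
  move=> e0; apply: chart_ball_nbhs; first exact: chart_dom_center.
  by rewrite subrr normr0 lt_min !divr_gt0// ltr_wpDl.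
have Ae (e x : R) : 0 < e -> 0 <= x -> x < e / (A + 1) -> A * x <= e.
  move=> e0 x0; rewrite ltr_pdivlMr ?ltr_wpDl// => /ltW; apply: le_trans.
  by rewrite mulrC ler_wpM2l// lerDl.
have r20 : 0 < r / 2 by rewrite divr_gt0.
(* With the initial gap at most [e1], the geometric series of step bounds sums to at most [r / 2];
   the other half of [r] is for reaching [p k0] from [pbar]. The [+ 1] allows dividing by [B + 1]
   when [B] is only known nonnegative. *)
pose e1 := ((r / 2) * (1 - theta) / (B + 1)) ^+ 2.
have e10 : 0 < e1 by rewrite exprn_gt0// divr_gt0 ?ltr_wpDl// mulr_gt0// subr_gt0.
have [k0 [_ [ck0]]] := close ord0 (near_nbhs _ r20) e10 0.
rewrite lt_min => /andP[/ltW near0 /Ae near0'] gap0.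
have [l0 l0A path0] := center_path bnd ck0 near0.
have l0r : l0 <= r / 2 by apply: (le_trans l0A); exact: near0'.
have start : piecewise_C1 pbar (p k0) l0.
  by rewrite -[l0]add0r; apply: path0; exact: piecewise_C1_refl.
pose s0 := Num.sqrt (gap k0); have s00 : 0 <= s0 by rewrite sqrtr_ge0.
have Bs0 : B * s0 <= (r / 2) * (1 - theta).
  have : s0 <= (r / 2) * (1 - theta) / (B + 1).
    have h : 0 <= (r / 2) * (1 - theta) / (B + 1).
      apply: divr_ge0; last exact: addr_ge0.
      by apply: mulr_ge0; [exact: ltW|rewrite subr_ge0 ltW].
    rewrite -(ger0_norm h) -sqrtr_sqr; apply: ler_wsqrtr.
    exact: le_trans (gap_le k0 ord0) gap0.
  rewrite ler_pdivlMr ?ltr_wpDl//; apply: le_trans.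
  by rewrite mulrC ler_wpM2l// lerDl.
(* Closed form of the partial geometric sum of the [theta ^+ i] for [i < j]. *)
pose geo (j : nat) : R := (1 - theta ^+ j) / (1 - theta).
have om0 : 0 < 1 - theta by rewrite subr_gt0.
have geoS j : geo j.+1 = geo j + theta ^+ j.
  by rewrite /geo exprS; field; rewrite gt_eqF.
have geo_le j : geo j <= (1 - theta)^-1.
  by rewrite /geo ler_pdivrMr// mulVf ?gt_eqF// gerBl exprn_ge0// ltW.
(* The length bound puts the current iterate in the ball, where [contract] applies; the decay of the
   gap then bounds the next step. *)
have inv j : (exists2 l, l <= r / 2 + B * s0 * geo j & piecewise_C1 pbar (p (k0 + j)) l)
    /\ Num.sqrt (gap (k0 + j)) <= s0 * theta ^+ j.
  elim: j => [|j [[l lr path] IH]].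
    rewrite addn0 expr0 mulr1; split => //; exists l0 => //.
    by rewrite /geo expr0 subrr mul0r mulr0 addr0.
  have inball : rball pbar r (p (k0 + j)).
    apply: le_trans (rdist_le path) _; apply: (le_trans lr).
    rewrite [leRHS](splitr r) lerD2l.
    apply: (@le_trans _ _ (B * s0 * (1 - theta)^-1)).
      by apply: ler_wpM2l; [exact: mulr_ge0|exact: geo_le].
    by rewrite ler_pdivrMr.
  split; last first.
    rewrite addnS; apply: (le_trans (contract _ inball)).
    by rewrite exprS mulrCA; apply: ler_wpM2l => //; exact: ltW.
  exists (l + run_step v t (k0 + j)); last by rewrite addnS; exact: (run_path hrun).
  rewrite geoS mulrDr addrA; apply: lerD => //.
  apply: (le_trans (run_step_gap _)); rewrite -[leRHS]mulrA.
  by apply: ler_wpM2l.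
have tail j i : exists2 l, l <= B * s0 * theta ^+ j * geo i &
    piecewise_C1 (p (k0 + j)) (p (k0 + j + i)) l.
  elim: i => [|i [l lr path]].
    rewrite addn0; exists 0; last exact: piecewise_C1_refl.
    by rewrite /geo expr0 subrr mul0r mulr0.
  exists (l + run_step v t (k0 + j + i)); last by rewrite addnS; exact: (run_path hrun).
  rewrite geoS mulrDr; apply: lerD => //.
  apply: (le_trans (run_step_gap _)).
  rewrite [leRHS](_ : _ = B * (s0 * (theta ^+ j * theta ^+ i))); last by ring.
  apply: ler_wpM2l => //; have [_] := inv (j + i)%N.
  by rewrite addnA exprD.
apply: (converges_linearly_eventually (K := k0) (C := B * s0 / (1 - theta)) (theta := theta)).
- by rewrite divr_ge0 ?mulr_ge0// ltW.
- by apply/andP.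
(* The path follows the run from [p (k0 + j)] to a late iterate close to [pbar], supplied by the
   cluster point, and ends with a coordinate segment of length at most [e]. *)
move=> j; apply/ler_addgt0Pr => e e0.
have [k [kj [ck]]] := close ord0 (near_nbhs _ e0) ltr01 (k0 + j).
rewrite lt_min => /andP[/ltW near1 /Ae near1'] _.
have [l' l'A path'] := path_center bnd ck near1.
have [l lB path] := tail j (k - (k0 + j))%N.
rewrite subnKC// in path.
apply: (le_trans (rdist_le (path' _ _ path))); apply: lerD; last first.
  by apply: (le_trans l'A); exact: near1'.
apply: (le_trans lB).
rewrite [leRHS]mulrAC; apply: ler_wpM2l; last exact: geo_le.
by rewrite mulr_ge0 ?mulr_ge0// exprn_ge0// ltW.
Qed.

End LinearConvergence.

(** * Assertion (i): convergence under quasi-convexity *)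

Section QuasiConvexConvergence.
Context {R : realType} {m n : nat} {M : riemannian R m}.
Variables (F : M -> 'rV[R]_n.+1) (sigma beta Rmax : R).
Variables (p : nat -> M) (v : forall k, tangent (p k)) (t : nat -> R) (pbar : M).
Hypotheses (hF : C1_map F) (hsigma : 0 < sigma < 1) (hbeta : 0 < beta < 1).
Hypothesis hRmax : 1 <= Rmax.
Hypothesis hrun : inexact_descent F sigma beta Rmax p v t.
Hypothesis hcompat : forall k, s_compatible F (p k) (v k).
Hypothesis hcluster : cluster (p @ \oo) pbar.

Lemma s_compatible_obtuse (y : R -> M) (u : tangent (y 0)) :
  geodesic 0 1 y -> s_compatible F (y 0) u ->
  (forall i (s : R), 0 <= s <= 1 -> F (y s) 0 i <= F (y 0) 0 i) ->
  0 <= inner (y 0) (velocity y 0) u.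
Proof.
move=> geo [a [a01 _ ->]] Fmax.
have i0 : 0 <= (0 : R) <= 1 by rewrite lexx ler01.
have Gsym := gram_sym (chart_dom_center (y 0)).
rewrite -[inner _ _ _]/(form _ _ _) formNr (form_sym _ _ Gsym) form_suml oppr_ge0.
apply: sumr_le0 => i _; rewrite formZl; apply: mulr_ge0_le0.
  by case/andP: (a01 i).
apply: (derive_le0_max (is_derive_objective i hF (geodesic_derivable geo i0))).
exact: Fmax.
Qed.

Lemma quasi_convex_convergence : quasi_convex_around F pbar -> p @ \oo --> pbar.
Proof.
move=> [rq [rq0 wc qc]].
have run_ge k i := run_limit_le hF hsigma hbeta hrun hcluster k i.
have [beta0 _] := andP hbeta.
have [rho [lam [K bnd]]] := chart_bounds_exist pbar.
have [rho0 lam0 K0 _] := bnd.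
have [r [C [r0 C0 hin]]] := hinge bnd.
set A := Num.sqrt (m%:R ^+ 2 * K).
have A0 : 0 <= A by rewrite sqrtr_ge0.
have A1 : 0 < A + 1 by rewrite ltr_wpDl.
set sl := Num.sqrt lam in hin; have sl0 : 0 < sl by rewrite sqrtr_gt0.
pose x q := chart pbar q - chart pbar pbar.
have Ae (e z : R) : 0 <= z -> z <= e / (A + 1) -> A * z <= e.
  move=> z0; rewrite ler_pdivlMr//; apply: le_trans.
  by rewrite mulrC ler_wpM2l// lerDl.
(* In order, the bounds allow coordinate segments to [pbar], the hinge inequality at the point,
   membership in the quasi-convexity ball, a minimal geodesic of speed at most [r], and its
   confinement to the chart. *)
pose rho1 := Num.min (rho / 2) (Num.min r
  (Num.min (rq / (A + 1)) (Num.min (r / (A + 1)) (sl * rho / 2 / (A + 1))))).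
have rho10 : 0 < rho1 by rewrite !lt_min r0/= !divr_gt0// mulr_gt0.
have pball : rball pbar rq pbar.
  by apply: le_trans (rdist_le (piecewise_C1_refl pbar)) _; exact: ltW.
(* The comparison of distance and coordinates in both directions: a segment gives the upper bound on
   [rdist], and the coordinate speed of the minimal geodesic, at most [rdist q pbar / sl], gives the
   bound on [|x q|]. *)
have minimal q : chart_dom pbar q -> `|x q| <= rho1 ->
    rdist q pbar <= A * `|x q| /\
    exists y : R -> M, [/\ geodesic 0 1 y, y 0 = q, y 1 = pbar,
      tnorm (y 0) (velocity y 0) = rdist q pbar &
      [/\ forall s, 0 <= s <= 1 -> rball pbar rq (y s), rdist q pbar <= r &
          `|x q| <= rdist q pbar / sl]].
  move=> cq; rewrite !le_min => /and5P[xr _ /Ae xq /Ae xr' /Ae xl].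
  have [l1 l1A path1] := center_path bnd cq xr.
  have [l2 l2A path2] := path_center bnd cq xr.
  have d1 : rdist pbar q <= A * `|x q|.
    apply: (le_trans (rdist_le (path1 _ _ (piecewise_C1_refl pbar)))).
    by rewrite add0r.
  have d2 : rdist q pbar <= A * `|x q|.
    apply: (le_trans (rdist_le (path2 _ _ (piecewise_C1_refl q)))).
    by rewrite add0r.
  have qball : rball pbar rq q by apply: (le_trans d1); exact: xq.
  have [y [geo y0 y1 len yball]] := wc _ _ qball pball.
  have yN : tnorm (y 0) (velocity y 0) = rdist q pbar.
    by rewrite -len (geodesic_length ler01 geo) subr0 mulr1.
  split => //; exists y; split => //; split => //.
    by apply: (le_trans d2); exact: xr'.
  have := geodesic_stays_rev bnd ler01 geo; rewrite /= y1 subrr normr0 add0r yN.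
  move=> /(_ (chart_dom_center pbar)); rewrite subr0 mulr1.
  have far : rdist q pbar / Num.sqrt lam < rho.
    rewrite ltr_pdivrMr// (le_lt_trans (le_trans d2 (xl _)))//.
    by rewrite -/sl (mulrC rho) ltr_pdivrMr// ltr_pMr ?mulr_gt0// ltr1n.
  have i0 : 0 <= (0 : R) <= 1 by rewrite lexx ler01.
  by move=> /(_ far 0 i0)[_]; rewrite y0 subr0 mulr1.
pose f k := F (p k) 0 ord0 - F pbar 0 ord0.
have f0 k : 0 <= f k by rewrite subr_ge0; exact: run_ge.
have fmono k : f k.+1 <= f k by rewrite lerD2r; exact: run_mono1 hsigma hbeta hrun _ _.
pose D := 2 * Rmax / beta.
have D0 : 0 < D by rewrite divr_gt0// mulr_gt0// (lt_le_trans ltr01).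
have stepf k : run_step v t k ^+ 2 <= D * (f k - f k.+1).
  have -> : f k - f k.+1 = F (p k) 0 ord0 - F (p k.+1) 0 ord0 by rewrite /f; ring.
  exact: run_gain_step hsigma hbeta hRmax hrun _ _.
(* the quasi-Fejer inequality in telescoped form *)
pose E k := rdist (p k) pbar ^+ 2 + C * D * f k.
have CD0 : 0 <= C * D by rewrite mulr_ge0// ltW.
have CD1 : 0 < C * D + 1 by rewrite ltr_wpDl.
have rdistE k : rdist (p k) pbar ^+ 2 <= E k by rewrite lerDl mulr_ge0.
have Estep k : chart_dom pbar (p k) -> `|x (p k)| <= rho1 -> run_step v t k <= r ->
    [/\ chart_dom pbar (p k.+1),
        `|chart pbar (p k.+1) - chart pbar (p k)| <= run_step v t k / sl &
        E k.+1 <= E k].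
  move=> ck xk stepr.
  have [_ [y [geo y0 y1 yN [yball dr _]]]] := minimal _ ck xk.
  have [gamma [ggeo g0 gv pE gS]] := run_geodesic hrun k.
  have Fmax i (s : R) : 0 <= s <= 1 -> F (y s) 0 i <= F (y 0) 0 i.
    move=> s01; rewrite y0.
    have qball : rball pbar rq (p k) by rewrite -y0; apply: yball; rewrite lexx ler01.
    have := qc _ _ y qball pball geo y0 y1 yball s s01 i.
    by rewrite mxE; move/le_trans; apply; rewrite ge_max lexx run_ge.
  have sc : s_compatible F (y 0) (v k : 'rV[R]_m) by rewrite y0; exact: hcompat.
  have perp := s_compatible_obtuse geo sc Fmax.
  have := hin y gamma (t k); rewrite yN gS y0 => H.
  have xkr : `|x (p k)| <= r.
    by apply: (le_trans xk); rewrite /rho1 !ge_min lexx orbT.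
  have [||ct cd dE] := H ck xkr geo y1 dr _ ggeo g0 stepr.
  - by rewrite ltW// (run_t_gt0 hrun).
  - by rewrite -y0 in gv *; rewrite gv.
  rewrite /E pE; split => //.
  apply: (@le_trans _ _ (rdist (p k) pbar ^+ 2 + C * run_step v t k ^+ 2 + C * D * f k.+1)).
    by rewrite lerD2r.
  rewrite -addrA lerD2l -(mulrA C) -mulrDr -(mulrA C); apply: ler_wpM2l => //.
  by rewrite -lerBrDr -mulrBr; exact: stepf.
(* Once an iterate is close to [pbar] with small [f], all later ones remain close. *)
have trap (eta : R) : 0 < eta -> eta <= sl * (rho1 / 2) ->
    exists K, forall k, (K <= k)%N ->
      chart_dom pbar (p k) /\ `|x (p k)| <= eta / sl.
  move=> eta0 etar.
  have etasl : eta / sl <= rho1 / 2 by rewrite ler_pdivrMr// mulrC.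
  (* A step up to [smax] is admissible for [hin] and moves the coordinates by at most [rho1 / 2]. *)
  pose smax := Num.min r (sl * (rho1 / 2)).
  have smax0 : 0 < smax by rewrite lt_min r0/= mulr_gt0// divr_gt0.
  (* The first bound leaves at most [eta ^+ 2 / 2] to the second term of [E]; the second forces
     every later step below [smax]. *)
  pose delta := Num.min (eta ^+ 2 / 2 / (C * D + 1)) (smax ^+ 2 / D).
  have delta0 : 0 < delta.
    rewrite lt_min; apply/andP; split; last by apply: divr_gt0 D0; exact: exprn_gt0.
    by apply: divr_gt0 CD1; apply: divr_gt0; first exact: exprn_gt0.
  have Unbhs : \forall q \near pbar, chart_dom pbar q /\
      `|chart pbar q - chart pbar pbar| < Num.min (rho1 / 2) (eta / 2 / (A + 1)).
    apply: chart_ball_nbhs; first exact: chart_dom_center.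
    by rewrite subrr normr0 lt_min !divr_gt0.
  have [k0 [_ [cK]]] := run_close hF hcluster ord0 Unbhs delta0 0.
  rewrite lt_min => /andP[/ltW xK /ltW /Ae xK'] fK.
  have rho12 : rho1 / 2 <= rho1 by rewrite ler_pdivrMr// ler_pMr// ler1n.
  have start : E k0 <= eta ^+ 2.
    have [dK _] := minimal _ cK (le_trans xK rho12).
    have h1 : rdist (p k0) pbar ^+ 2 <= (eta / 2) ^+ 2.
      rewrite ler_sqr ?nnegrE ?rdist_ge0 ?divr_ge0 ?(ltW eta0)//.
      by apply: (le_trans dK); exact: xK'.
    have h2 : C * D * f k0 <= eta ^+ 2 / 2.
      have : f k0 <= eta ^+ 2 / 2 / (C * D + 1).
        by apply: (le_trans fK); rewrite ge_min lexx.
      rewrite ler_pdivlMr//; apply: le_trans.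
      by rewrite mulrC ler_wpM2l// lerDl.
    apply: (le_trans (lerD h1 h2)); rewrite expr_div_n -mulrDr.
    by rewrite ler_piMr ?sqr_ge0//; lra.
  (* A step first yields only [|x| <= rho1], the sum of two halves. That suffices for [minimal], and
     [E <= eta ^+ 2] then restores the bound [rho1 / 2], so the radius does not deteriorate. *)
  have inv j : [/\ chart_dom pbar (p (k0 + j)), `|x (p (k0 + j))| <= rho1 / 2,
      f (k0 + j)%N <= delta & E (k0 + j)%N <= eta ^+ 2].
    elim: j => [|j [cj xj fj Ej]].
      by rewrite addn0; split => //; exact: fK.
    rewrite addnS; set k := (k0 + j)%N in cj xj fj Ej *.
    have stepmax : run_step v t k <= smax.
      rewrite -ler_sqr ?nnegrE ?(ltW smax0) ?(run_step_ge0 hrun)//.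
      apply: (le_trans (stepf k)); rewrite -ler_pdivlMl// mulrC.
      have : f k <= smax ^+ 2 / D by apply: (le_trans fj); rewrite ge_min lexx orbT.
      by apply: le_trans; rewrite gerBl.
    have stepr : run_step v t k <= r.
      by apply: (le_trans stepmax); rewrite ge_min lexx.
    have stepx : run_step v t k / sl <= rho1 / 2.
      rewrite ler_pdivrMr// mulrC; apply: (le_trans stepmax).
      by rewrite ge_min lexx orbT.
    have [ck dk Ek] := Estep k cj (le_trans xj rho12) stepr.
    have xk1 : `|x (p k.+1)| <= rho1.
      rewrite [leRHS](splitr rho1).
      have -> : x (p k.+1) = (chart pbar (p k.+1) - chart pbar (p k)) + x (p k).
        by rewrite /x addrA subrK.
      by apply: (le_trans (ler_normD _ _)); apply: lerD => //; exact: le_trans dk stepx.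
    have Ek1 := le_trans Ek Ej.
    split => //; last exact: le_trans (fmono k) fj.
    have [_ [y [_ _ _ _ [_ _ xd]]]] := minimal _ ck xk1.
    apply: (le_trans xd); apply: le_trans etasl; rewrite ler_pM2r ?invr_gt0//.
    rewrite -ler_sqr ?nnegrE ?rdist_ge0 ?(ltW eta0)//.
    exact: le_trans (rdistE _) Ek1.
  exists k0 => k Kk; have [ck xk _ Ek] := inv (k - k0)%N.
  rewrite subnKC// in ck xk Ek; split => //.
  have [_ [y [_ _ _ _ [_ _ xd]]]] := minimal _ ck (le_trans xk rho12).
  apply: (le_trans xd); rewrite ler_pM2r ?invr_gt0//.
  rewrite -ler_sqr ?nnegrE ?rdist_ge0 ?(ltW eta0)//.
  exact: le_trans (rdistE _) Ek.
move=> U Unbhs.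
have /nbhs_ballP[e /= e0 eU] : \forall z \near chart pbar pbar, U (chart_inv pbar z).
  apply: (chart_inv_continuous (chart_dom_center pbar)).
  by rewrite chartK//; exact: chart_dom_center.
pose eta := Num.min (sl * (rho1 / 2)) (sl * (e / 2)).
have eta0 : 0 < eta by rewrite lt_min !mulr_gt0// divr_gt0.
have [|K1 HK1] := trap eta eta0; first by rewrite ge_min lexx.
exists K1 => // k /= /HK1[ck xk]; rewrite -(chartK ck); apply: eU.
rewrite -ball_normE /ball_/= distrC (le_lt_trans xk)// ltr_pdivrMr// mulrC.
rewrite (@le_lt_trans _ _ (sl * (e / 2)))//; first by rewrite ge_min lexx orbT.
by rewrite ltr_pM2l// ltr_pdivrMr// ltr_pMr// ltr1n.
Qed.

End QuasiConvexConvergence.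

Theorem theorem5p1 (R : realType) (m n : nat) (M : riemannian R m)
    (hconn : connected [set: M]) (hcomplete : geodesically_complete M)
    (F : M -> 'rV[R]_n.+1) (hF : C1_map F)
    (sigma beta Rmax : R) (hsigma : 0 < sigma < 1) (hbeta : 0 < beta < 1)
    (hRmax : 1 <= Rmax)
    (p : nat -> M) (v : forall k, tangent (p k)) (t : nat -> R)
    (hrun : inexact_descent F sigma beta Rmax p v t)
    (hcompat : forall k, s_compatible F (p k) (v k))
    (pbar : M) (hcluster : cluster (p @ \oo) pbar) :
  (pareto_critical F pbar -> quasi_convex_around F pbar ->
     p @ \oo --> pbar)
  /\
  (weak_pareto_optimum F pbar -> 0 < inf (range t) ->
     (exists a r : R, [/\ 0 < a, 0 < r &
        forall q, rball pbar r q ->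
          (a%:E * phi F q <=
             (tnorm q (steepest_descent F q) ^+ 2)%:E)%E]) ->
     converges_linearly p pbar).
Proof.
split=> [_ qc|_ tau0 growth].
  exact: (quasi_convex_convergence hF hsigma hbeta hRmax hrun hcompat hcluster qc).
exact: (linear_convergence hF hsigma hbeta hRmax hrun hcluster tau0 growth).
Qed.
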